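(* Let $R>0$. For any fixed $\gamma\in 2\mathbb{N}$, $\boldsymbol{y}\in B_R$ and $\boldsymbol{\alpha}\in S$, we have $$\lim_{|\boldsymbol{z}|\to R}K_{(\boldsymbol y,\boldsymbol\alpha)}(\boldsymbol z,\boldsymbol\beta)=0\qquad(\boldsymbol z\in B_R),$$ and this limit is uniform for all $\boldsymbol{\beta}\in S$; here $K_{(\boldsymbol y,\boldsymbol\alpha)}$ is the point spread function with parameter $\gamma$.
   Context: $\mathbb{N}$ is the set of non-negative integers, so $2\mathbb{N}=\{0,2,4,\dots\}$. $B_R\subset\mathbb{R}^3$ is the open ball of radius $R$ centered at the origin and $\Gamma=\partial B_R$ is the sphere of radius $R$. $S=\{\boldsymbol\alpha\in\mathbb{C}^3: |\boldsymbol\alpha|=1\}$ is the set of complex unit vectors. $\Delta_\Gamma$ is the Laplace-Beltrami operator on $\Gamma$, applied componentwise to vector-valued functions, and $(-\Delta_\Gamma)^0$ is the identity. For $\gamma\in2\mathbb{N}$, $\boldsymbol a\in L^2(\Gamma)^3$ and $\boldsymbol b\in H^{2\gamma}(\Gamma)^3$ (complex vector valued), $$\langle\boldsymbol a,\boldsymbol b\rangle_\gamma:=\int_\Gamma \boldsymbol a\cdot\overline{(-\Delta_\Gamma)^\gamma\boldsymbol b}\,d\Gamma,$$ where $\cdot$ is the bilinear dot product $\boldsymbol u\cdot\boldsymbol v=\sum_i u_iv_i$. On $H^{2\gamma}(\Gamma)^3$ this is Hermitian and positive semi-definite, and the induced semi-norm is $|\boldsymbol b|_\gamma=\langle\boldsymbol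 b,\boldsymbol b\rangle_\gamma^{1/2}=\left(\int_\Gamma|(-\Delta_\Gamma)^{\gamma/2}\boldsymbol b|^2\,d\Gamma\right)^{1/2}$. Let $G(\boldsymbol x,\boldsymbol y)=\frac{1}{4\pi|\boldsymbol x-\boldsymbol y|}$, so $\nabla_{\boldsymbol x}G(\boldsymbol x,\boldsymbol y)=-\frac{\boldsymbol x-\boldsymbol y}{4\pi|\boldsymbol x-\boldsymbol y|^3}$. For $\boldsymbol y,\boldsymbol z\in B_R$ and $\boldsymbol\alpha,\boldsymbol\beta\in S$, the point spread function with parameter $\gamma$ is $$K_{(\boldsymbol y,\boldsymbol\alpha)}(\boldsymbol z,\boldsymbol\beta):=\frac{\langle\nabla_{\boldsymbol x}G(\cdot,\boldsymbol y)\times\boldsymbol\alpha,\ \nabla_{\boldsymbol x}G(\cdot,\boldsymbol z)\times\boldsymbol\beta\rangle_\gamma}{|\nabla_{\boldsymbol x}G(\cdot,\boldsymbol z)\times\boldsymbol\beta|_\gamma},$$ where the functions are regarded as functions of $\boldsymbol x\in\Gamma$, $\Delta_\Gamma$ acts in $\boldsymbol x$, and $\times$ is the cross product extended bilinearly to $\mathbb{C}^3$. (The denominator is nonzero.) *)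

(* Defs.v *)
From Stdlib Require Import Reals Arith.
From Coquelicot Require Import Coquelicot.

Local Open Scope R_scope.

Definition R3 : Type := (R * R * R)%type.
Definition C3 : Type := (C * C * C)%type.

Definition norm3 (x : R3) : R :=
  let '(x1, x2, x3) := x in sqrt (x1 ^ 2 + x2 ^ 2 + x3 ^ 2).

Definition sub3 (x y : R3) : R3 :=
  let '(x1, x2, x3) := x in
  let '(y1, y2, y3) := y in (x1 - y1, x2 - y2, x3 - y3).

Definition scal3 (t : R) (x : R3) : R3 :=
  let '(x1, x2, x3) := x in (t * x1, t * x2, t * x3).

Definition cnorm3 (a : C3) : R :=
  let '(a1, a2, a3) := a in sqrt (Cmod a1 ^ 2 + Cmod a2 ^ 2 + Cmod a3 ^ 2).

Definition in_ball (r : R) (x : R3) : Prop := norm3 x < r.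

Definition unit_vec (a : C3) : Prop := cnorm3 a = 1.

(* Bilinear: no conjugation. *)
Definition dot3 (a b : C3) : C :=
  let '(a1, a2, a3) := a in
  let '(b1, b2, b3) := b in (a1 * b1 + a2 * b2 + a3 * b3)%C.

Definition cross3 (a b : C3) : C3 :=
  let '(a1, a2, a3) := a in
  let '(b1, b2, b3) := b in
  ((a2 * b3 - a3 * b2)%C, (a3 * b1 - a1 * b3)%C, (a1 * b2 - a2 * b1)%C).

Definition conj3 (a : C3) : C3 :=
  let '(a1, a2, a3) := a in (Cconj a1, Cconj a2, Cconj a3).

Definition comp1 (a : C3) : C := fst (fst a).
Definition comp2 (a : C3) : C := snd (fst a).
Definition comp3 (a : C3) : C := snd a.

(* Derivative of a complex-valued function of a real variable. *)
Definition CDerive (f : R -> C) (t : R) : C :=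
  (Derive (fun s => Re (f s)) t, Derive (fun s => Im (f s)) t).

Definition grad (f : R3 -> C) (x : R3) : C3 :=
  let '(x1, x2, x3) := x in
  (CDerive (fun t => f (t, x2, x3)) x1,
   CDerive (fun t => f (x1, t, x3)) x2,
   CDerive (fun t => f (x1, x2, t)) x3).

Definition divergence (v : R3 -> C3) (x : R3) : C :=
  (comp1 (grad (fun w => comp1 (v w)) x)
   + comp2 (grad (fun w => comp2 (v w)) x)
   + comp3 (grad (fun w => comp3 (v w)) x))%C.

(* A function on the sphere of radius r is represented by a function on R3.
   The surface operators below only depend on its values on that sphere,
   because they first replace it by its extension x |-> f (r x / |x|), which
   is constant along normals.  The gradient of that extension on the sphere is
   the tangential gradient of f, and the divergence of the corresponding
   extension of a vector field is its surface divergence.  The results are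
   meaningful at points of the sphere only. *)
Definition proj_sphere (r : R) (x : R3) : R3 := scal3 (r / norm3 x) x.

Definition surf_grad (r : R) (f : R3 -> C) (x : R3) : C3 :=
  grad (fun w => f (proj_sphere r w)) x.

Definition surf_div (r : R) (v : R3 -> C3) (x : R3) : C :=
  divergence (fun w => v (proj_sphere r w)) x.

Definition laplace_beltrami (r : R) (f : R3 -> C) (x : R3) : C :=
  surf_div r (surf_grad r f) x.

Definition neg_lap3 (r : R) (b : R3 -> C3) (x : R3) : C3 :=
  ((- laplace_beltrami r (fun w => comp1 (b w)) x)%C,
   (- laplace_beltrami r (fun w => comp2 (b w)) x)%C,
   (- laplace_beltrami r (fun w => comp3 (b w)) x)%C).

Definition neg_lap3_pow (r : R) (n : nat) (b : R3 -> C3) : R3 -> C3 :=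
  Nat.iter n (neg_lap3 r) b.

Definition sphere_point (r theta phi : R) : R3 :=
  (r * (sin theta * cos phi), r * (sin theta * sin phi), r * cos theta).

(* Surface integral over the sphere of radius r: theta is the polar angle, phi
   the azimuth, and r ^ 2 * sin theta the area density of sphere_point. *)
Definition surf_int (r : R) (f : R3 -> C) : C :=
  RInt (V := C_R_CompleteNormedModule) (fun theta =>
    RInt (V := C_R_CompleteNormedModule) (fun phi =>
      (RtoC (r ^ 2 * sin theta) * f (sphere_point r theta phi))%C)
    0 (2 * PI))
  0 PI.

Definition pairing (r : R) (gamma : nat) (a b : R3 -> C3) : C :=
  surf_int r (fun x => dot3 (a x) (conj3 (neg_lap3_pow r gamma b x))).

(* pairing r gamma b b is a nonnegative real for even gamma and smooth b. *)
Definition seminorm (r : R) (gamma : nat) (b : R3 -> C3) : R :=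
  sqrt (Re (pairing r gamma b b)).

Definition green (x y : R3) : R := / (4 * PI * norm3 (sub3 x y)).

Definition dipole (y : R3) (a : C3) (x : R3) : C3 :=
  cross3 (grad (fun w => RtoC (green w y)) x) a.

Definition psf (r : R) (gamma : nat) (y : R3) (alpha : C3)
    (z : R3) (beta : C3) : C :=
  (pairing r gamma (dipole y alpha) (dipole z beta)
   / RtoC (seminorm r gamma (dipole z beta)))%C.

(* Main.v *)
(* The components of the dipole field restricted to the sphere are polynomials
   in x and u = 1/|x-z|, a class stable under tangential differentiation, with
   constants uniform in z and beta.  Writing L for minus the Laplace-Beltrami
   operator and gamma = 2m, self-adjointness gives
     <a, b>_gamma = <L^gamma a, b>  and  |b|_gamma^2 = |L^m b|^2.
   The numerator is therefore at most a constant times the integral of u^2.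
   A Poincare inequality |f|^2 <= A |L f|^2 + B, valid uniformly for functions
   that are bounded away from z/|z|, reduces the denominator to |b|^2, which the
   divergence theorem applied to zonal and rotation fields bounds below by a
   multiple of the integral of u^4, up to a constant.  That integral equals
   4 pi r^2 / (r^2 - |z|^2)^2, while the integral of u is bounded, so by
   interpolation the integral of u^2 is of smaller order than its square root. *)

Require Import Defs.
From Stdlib Require Import Reals Arith Lra Nsatz.
From Coquelicot Require Import Coquelicot.

Local Open Scope R_scope.

(** * Iterated integrals of continuous functions *)

(** Uniformity is the obstacle: the field blows up as z nears the sphere, and no constant may depend
    on z or beta. Functions are therefore given by a syntax, [sexpr], whose derivatives and bounds
    are found by recursion on the expression before z and p are chosen. The polarisation enters
    linearly, so the analysis is done for a real vector p, applied to the real and to the imaginary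
    part of beta. No local expansion at z/|z| is made. The moments of u come from divergences
    integrated over the whole sphere, combined with 2 x.z = r^2 + |z|^2 - 1/u^2. The lower bound for
    |b|^2 cannot be pointwise, since (x-z) x p vanishes where x-z is parallel to p; integrals of
    rotation derivatives about z repair this. A Poincare inequality with the mean removed would
    leave the means to be controlled. The weight 2 x.z / r^2 is instead positive near the
    singularity, and elsewhere the function itself is uniformly bounded. Derivatives in the
    spherical angles serve only to prove [sint_grad]; from there on tangential derivatives are
    Cartesian, and the poles of the coordinates no longer matter. *)

Definition cont2 (F : R -> R -> R) : Prop :=
  forall s t, continuity_2d_pt F s t.

Lemma cont2_const (c : R) : cont2 (fun _ _ => c).
Proof. intros s t; apply continuity_2d_pt_const. Qed.

Lemma cont2_plus (F G : R -> R -> R) :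
  cont2 F -> cont2 G -> cont2 (fun s t => F s t + G s t).
Proof. intros hF hG s t; apply continuity_2d_pt_plus; auto. Qed.

Lemma cont2_mult (F G : R -> R -> R) :
  cont2 F -> cont2 G -> cont2 (fun s t => F s t * G s t).
Proof. intros hF hG s t; apply continuity_2d_pt_mult; auto. Qed.

Lemma cont2_fst (h : R -> R) : continuity h -> cont2 (fun s _ => h s).
Proof.
  intros hh s t.
  apply (continuity_1d_2d_pt_comp h (fun u _ => u)).
  - apply hh.
  - apply continuity_2d_pt_id1.
Qed.

Lemma cont2_snd (h : R -> R) : continuity h -> cont2 (fun _ t => h t).
Proof.
  intros hh s t.
  apply (continuity_1d_2d_pt_comp h (fun _ v => v)).
  - apply hh.
  - apply continuity_2d_pt_id2.
Qed.

Lemma cont2_ext (F G : R -> R -> R) :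
  (forall s t, F s t = G s t) -> cont2 F -> cont2 G.
Proof. intros e hF s t; apply continuity_2d_pt_ext with F; auto. Qed.

Lemma cont2_continuous_snd (F : R -> R -> R) (s t : R) :
  cont2 F -> continuous (F s) t.
Proof.
  intros hF.
  apply (proj1 (continuity_pt_filterlim (F s) t)).
  apply continuity_pt_locally; intros eps.
  destruct (hF s t eps) as [d hd].
  exists d; intros v hv; apply hd.
  - rewrite Rminus_diag, Rabs_R0; apply cond_pos.
  - exact hv.
Qed.

Lemma cont2_ex_RInt (F : R -> R -> R) (s a b : R) :
  cont2 F -> ex_RInt (F s) a b.
Proof.
  intros hF; apply (ex_RInt_continuous (V := R_CompleteNormedModule)).
  intros; apply cont2_continuous_snd; exact hF.
Qed.

Lemma continuous_RInt_param (F : R -> R -> R) (a b s : R) :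
  a <= b -> cont2 F -> continuous (fun u => RInt (F u) a b) s.
Proof.
  intros hab hF.
  apply (proj1 (continuity_pt_filterlim (fun u => RInt (F u) a b) s)).
  apply continuity_pt_locally; intros eps.
  (* The [+ 1] covers a = b and makes (b - a) times this bound strictly smaller than eps. *)
  assert (he : 0 < eps / (b - a + 1)).
  { apply Rdiv_lt_0_compat; [apply cond_pos | lra]. }
  destruct (uniform_continuity_2d_1d' F a b s (fun x _ => hF s x) (mkposreal _ he))
    as [d hd]; simpl in hd.
  exists d; intros u hu.
  assert (hu' : Rabs (u - s) < d) by exact hu.
  apply Rabs_def2 in hu'.
  pose proof (cond_pos d) as hdpos.
  rewrite <- (RInt_minus (V := R_CompleteNormedModule) (F u) (F s))
    by (apply cont2_ex_RInt; exact hF).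
  apply Rle_lt_trans with ((b - a) * (eps / (b - a + 1))).
  - apply abs_RInt_le_const.
    + exact hab.
    + apply (ex_RInt_minus (V := R_NormedModule)); apply cont2_ex_RInt; exact hF.
    + intros t ht; left; apply hd; try lra.
      rewrite Rminus_diag, Rabs_R0; exact hdpos.
  - pose proof (cond_pos eps).
    replace ((b - a) * (eps / (b - a + 1))) with (eps - eps / (b - a + 1))
      by (field; lra).
    lra.
Qed.

Definition dint (F : R -> R -> R) : R :=
  RInt (fun s => RInt (F s) 0 (2 * PI)) 0 PI.

Lemma two_PI_pos : 0 <= 2 * PI.
Proof. pose proof PI_RGT_0; lra. Qed.

Lemma dint_ex_outer (F : R -> R -> R) (a b : R) :
  cont2 F -> ex_RInt (fun s => RInt (F s) 0 (2 * PI)) a b.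
Proof.
  intros hF; apply (ex_RInt_continuous (V := R_CompleteNormedModule)).
  intros; apply continuous_RInt_param; [apply two_PI_pos | exact hF].
Qed.

Lemma dint_ext (F G : R -> R -> R) :
  (forall s t, 0 < s < PI -> F s t = G s t) -> dint F = dint G.
Proof.
  intros e; unfold dint.
  apply RInt_ext; intros s hs.
  apply RInt_ext; intros t _.
  rewrite Rmin_left, Rmax_right in hs by (pose proof PI_RGT_0; lra).
  auto.
Qed.

Lemma dint_plus (F G : R -> R -> R) :
  cont2 F -> cont2 G -> dint (fun s t => F s t + G s t) = dint F + dint G.
Proof.
  intros hF hG; unfold dint.
  rewrite <- (RInt_plus (V := R_CompleteNormedModule)
    (fun s => RInt (F s) 0 (2 * PI)) (fun s => RInt (G s) 0 (2 * PI)))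
    by (apply dint_ex_outer; assumption).
  apply RInt_ext; intros s _.
  apply (RInt_plus (V := R_CompleteNormedModule) (F s) (G s));
    apply cont2_ex_RInt; assumption.
Qed.

Lemma dint_scal (c : R) (F : R -> R -> R) :
  cont2 F -> dint (fun s t => c * F s t) = c * dint F.
Proof.
  intros hF; unfold dint.
  rewrite <- (RInt_scal (V := R_CompleteNormedModule)
    (fun s => RInt (F s) 0 (2 * PI))) by (apply dint_ex_outer; assumption).
  apply RInt_ext; intros s _.
  apply (RInt_scal (V := R_CompleteNormedModule) (F s)).
  apply cont2_ex_RInt; assumption.
Qed.

Lemma dint_le (F G : R -> R -> R) :
  cont2 F -> cont2 G ->
  (forall s t, 0 < s < PI -> F s t <= G s t) -> dint F <= dint G.
Proof.
  intros hF hG hle; unfold dint.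
  apply RInt_le.
  - pose proof PI_RGT_0; lra.
  - apply dint_ex_outer; assumption.
  - apply dint_ex_outer; assumption.
  - intros s hs; apply RInt_le.
    + apply two_PI_pos.
    + apply cont2_ex_RInt; assumption.
    + apply cont2_ex_RInt; assumption.
    + auto.
Qed.

Lemma dint_derive_snd (B DB : R -> R -> R) :
  cont2 DB -> (forall s t, is_derive (B s) t (DB s t)) ->
  (forall s, B s (2 * PI) = B s 0) -> dint DB = 0.
Proof.
  intros hc hd hper; unfold dint.
  rewrite (RInt_ext _ (fun _ => 0)).
  - rewrite RInt_const; unfold scal; simpl; unfold mult; simpl; ring.
  - intros s _; apply is_RInt_unique.
    replace 0 with (minus (B s (2 * PI)) (B s 0)) at 2
      by (rewrite hper; unfold minus, plus, opp; simpl; ring).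
    apply (is_RInt_derive (V := R_CompleteNormedModule) (B s) (DB s)).
    + intros; apply hd.
    + intros; apply cont2_continuous_snd; exact hc.
Qed.

(** Differentiation under the azimuthal integral turns the outer integrand into the derivative of
    [J], and [J] vanishes at both poles. *)
Lemma dint_derive_fst (A DA : R -> R -> R) :
  cont2 A -> cont2 DA -> (forall s t, is_derive (fun u => A u t) s (DA s t)) ->
  (forall t, A 0 t = 0) -> (forall t, A PI t = 0) -> dint DA = 0.
Proof.
  intros hA hc hd h0 hpi; unfold dint.
  set (J := fun s => RInt (A s) 0 (2 * PI)).
  assert (hJ : forall s, is_derive J s (RInt (DA s) 0 (2 * PI))).
  { intros s.
    assert (e : forall u t, Derive (fun w => A w t) u = DA u t)
      by (intros; apply is_derive_unique; apply hd).
    rewrite <- (RInt_ext (fun t => Derive (fun w => A w t) s)) by (intros; apply e).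
    apply (is_derive_RInt_param A).
    - apply filter_forall; intros u t _; eexists; apply hd.
    - intros t _; apply continuity_2d_pt_ext with DA.
      + intros; symmetry; apply e.
      + apply hc.
    - apply filter_forall; intros u; apply cont2_ex_RInt; exact hA. }
  apply is_RInt_unique.
  assert (z : forall s, (forall t, A s t = 0) -> J s = 0).
  { intros s hs; unfold J; rewrite (RInt_ext _ (fun _ => 0)) by (intros; apply hs).
    rewrite RInt_const; unfold scal; simpl; unfold mult; simpl; ring. }
  replace 0 with (minus (J PI) (J 0)) at 2
    by (rewrite !z by assumption; unfold minus, plus, opp; simpl; ring).
  apply (is_RInt_derive (V := R_CompleteNormedModule) J).
  - intros; apply hJ.
  - intros; apply continuous_RInt_param; [apply two_PI_pos | exact hc].
Qed.

Lemma dint_sin (c : R) : dint (fun s _ => c * sin s) = 4 * PI * c.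
Proof.
  unfold dint.
  rewrite (RInt_ext _ (fun s => scal (2 * PI * c) (sin s))).
  - rewrite (RInt_scal (V := R_CompleteNormedModule) sin).
    + rewrite (is_RInt_unique sin 0 PI (minus (- cos PI) (- cos 0))).
      * rewrite cos_PI, cos_0; unfold scal, minus, plus, opp; simpl; unfold mult; simpl; ring.
      * apply (is_RInt_derive (V := R_CompleteNormedModule) (fun s => - cos s) sin).
        -- intros; auto_derive; [trivial | ring].
        -- intros; apply (proj1 (continuity_pt_filterlim sin x)); apply continuity_sin.
    + apply (ex_RInt_continuous (V := R_CompleteNormedModule)); intros.
      apply (proj1 (continuity_pt_filterlim sin z)); apply continuity_sin.
  - intros s _; rewrite RInt_const; unfold scal; simpl; unfold mult; simpl; ring.
Qed.

(** * Functions on the sphere and their tangential gradients *)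

Inductive axis : Set := Ax1 | Ax2 | Ax3.

Definition coord (i : axis) (x : R3) : R :=
  match i with Ax1 => fst (fst x) | Ax2 => snd (fst x) | Ax3 => snd x end.

Definition sum3 (F : axis -> R) : R := F Ax1 + F Ax2 + F Ax3.

Definition dotr (x y : R3) : R := sum3 (fun i => coord i x * coord i y).

Definition kron (i j : axis) : R :=
  match i, j with Ax1, Ax1 => 1 | Ax2, Ax2 => 1 | Ax3, Ax3 => 1 | _, _ => 0 end.

Definition on_sphere (r : R) (x : R3) : Prop := dotr x x = r ^ 2.

Lemma norm3_dotr (x : R3) : norm3 x = sqrt (dotr x x).
Proof.
  destruct x as [[x1 x2] x3]; unfold norm3, dotr, sum3; simpl; f_equal; ring.
Qed.

Lemma dotr_self_pos (x : R3) : 0 <= dotr x x.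
Proof. unfold dotr, sum3; nra. Qed.

Lemma norm3_sqr (x : R3) : norm3 x ^ 2 = dotr x x.
Proof. rewrite norm3_dotr; apply pow2_sqrt, dotr_self_pos. Qed.

Lemma norm3_pos (x : R3) : 0 <= norm3 x.
Proof. rewrite norm3_dotr; apply sqrt_pos. Qed.

Lemma on_sphere_norm3 (r : R) (x : R3) : 0 < r -> on_sphere r x -> norm3 x = r.
Proof.
  intros hr h; rewrite norm3_dotr, h; apply sqrt_pow2; lra.
Qed.

Lemma sphere_point_on_sphere (r s t : R) : on_sphere r (sphere_point r s t).
Proof.
  unfold on_sphere, dotr, sum3, sphere_point; simpl.
  pose proof (sin2_cos2 s) as e1; pose proof (sin2_cos2 t) as e2; unfold Rsqr in *.
  transitivity (r * r * (sin s * sin s * (sin t * sin t + cos t * cos t) + cos s * cos s));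
    [ring|].
  rewrite e2; replace (sin s * sin s * 1 + cos s * cos s) with 1 by lra; ring.
Qed.

Definition sph_cont (r : R) (f : R3 -> R) : Prop :=
  cont2 (fun s t => f (sphere_point r s t)).

Definition sint (r : R) (f : R3 -> R) : R :=
  dint (fun s t => r ^ 2 * sin s * f (sphere_point r s t)).

Lemma cont2_density (r : R) (f : R3 -> R) :
  sph_cont r f -> cont2 (fun s t => r ^ 2 * sin s * f (sphere_point r s t)).
Proof.
  intros hf; apply cont2_mult; [|exact hf].
  apply cont2_mult; [apply cont2_const | apply cont2_fst, continuity_sin].
Qed.

Lemma sph_cont_const (r c : R) : sph_cont r (fun _ => c).
Proof. exact (cont2_const c). Qed.

Lemma sph_cont_plus (r : R) (f g : R3 -> R) :
  sph_cont r f -> sph_cont r g -> sph_cont r (fun x => f x + g x).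
Proof. apply cont2_plus. Qed.

Lemma sph_cont_mult (r : R) (f g : R3 -> R) :
  sph_cont r f -> sph_cont r g -> sph_cont r (fun x => f x * g x).
Proof. apply cont2_mult. Qed.

Lemma sph_cont_ext (r : R) (f g : R3 -> R) :
  (forall x, on_sphere r x -> f x = g x) -> sph_cont r f -> sph_cont r g.
Proof.
  intros e; apply cont2_ext; intros; apply e, sphere_point_on_sphere.
Qed.

Lemma sph_cont_coord (r : R) (i : axis) : sph_cont r (coord i).
Proof.
  destruct i; unfold sph_cont; simpl;
    repeat first [apply cont2_mult | apply cont2_const
                 | apply (cont2_fst sin), continuity_sin
                 | apply (cont2_fst cos), continuity_cos
                 | apply (cont2_snd sin), continuity_sin
                 | apply (cont2_snd cos), continuity_cos].
Qed.

Lemma sint_ext (r : R) (f g : R3 -> R) :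
  (forall x, on_sphere r x -> f x = g x) -> sint r f = sint r g.
Proof.
  intros e; apply dint_ext; intros; rewrite e; auto using sphere_point_on_sphere.
Qed.

Lemma sint_plus (r : R) (f g : R3 -> R) :
  sph_cont r f -> sph_cont r g ->
  sint r (fun x => f x + g x) = sint r f + sint r g.
Proof.
  intros hf hg; unfold sint.
  rewrite <- dint_plus by (apply cont2_density; assumption).
  apply dint_ext; intros; ring.
Qed.

Lemma sint_scal (r c : R) (f : R3 -> R) :
  sph_cont r f -> sint r (fun x => c * f x) = c * sint r f.
Proof.
  intros hf; unfold sint.
  rewrite <- dint_scal by (apply cont2_density; assumption).
  apply dint_ext; intros; ring.
Qed.

Lemma sint_le (r : R) (f g : R3 -> R) :
  sph_cont r f -> sph_cont r g ->
  (forall x, on_sphere r x -> f x <= g x) -> sint r f <= sint r g.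
Proof.
  intros hf hg hle; apply dint_le; try (apply cont2_density; assumption).
  intros s t hs; apply Rmult_le_compat_l.
  - pose proof (sin_gt_0 s (proj1 hs) (proj2 hs)); nra.
  - apply hle, sphere_point_on_sphere.
Qed.

Lemma sint_const (r c : R) : sint r (fun _ => c) = 4 * PI * r ^ 2 * c.
Proof.
  unfold sint; rewrite (dint_ext _ (fun s _ => (r ^ 2 * c) * sin s)) by (intros; ring).
  rewrite dint_sin; ring.
Qed.

Lemma sint_abs_le (r : R) (f g : R3 -> R) :
  sph_cont r f -> sph_cont r g ->
  (forall x, on_sphere r x -> Rabs (f x) <= g x) -> Rabs (sint r f) <= sint r g.
Proof.
  intros hf hg hle.
  assert (h : forall x, on_sphere r x -> - g x <= f x <= g x).
  { intros x hx; apply Rabs_le_between, hle, hx. }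
  apply Rabs_le; split.
  - replace (- sint r g) with (sint r (fun x => -1 * g x))
      by (rewrite sint_scal by assumption; ring).
    apply sint_le; auto using sph_cont_mult, sph_cont_const.
    intros x hx; specialize (h x hx); lra.
  - apply sint_le; auto; intros x hx; apply h, hx.
Qed.

Lemma sint_sum3 (r : R) (F : axis -> R3 -> R) :
  (forall i, sph_cont r (F i)) ->
  sint r (fun x => sum3 (fun i => F i x)) = sum3 (fun i => sint r (F i)).
Proof.
  intros h; unfold sum3; rewrite !sint_plus; auto using sph_cont_plus.
Qed.

Lemma sph_cont_sum3 (r : R) (F : axis -> R3 -> R) :
  (forall i, sph_cont r (F i)) -> sph_cont r (fun x => sum3 (fun i => F i x)).
Proof. intros h; unfold sum3; auto using sph_cont_plus. Qed.

(* [Tf] is the tangential gradient of [f] on the sphere, characterised by the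
   chain rule along curves tangent to the sphere at one of its points. *)
Record tangential (r : R) (f : R3 -> R) (Tf : axis -> R3 -> R) : Prop := {
  tg_cont : sph_cont r f;
  tg_cont_grad : forall i, sph_cont r (Tf i);
  tg_normal : forall x, on_sphere r x -> sum3 (fun i => coord i x * Tf i x) = 0;
  tg_chain : forall (c1 c2 c3 : R -> R) (t d1 d2 d3 : R),
    let x := (c1 t, c2 t, c3 t) in
    is_derive c1 t d1 -> is_derive c2 t d2 -> is_derive c3 t d3 ->
    on_sphere r x -> dotr x (d1, d2, d3) = 0 ->
    is_derive (fun u => f (c1 u, c2 u, c3 u)) t (dotr (Tf Ax1 x, Tf Ax2 x, Tf Ax3 x) (d1, d2, d3))
}.

Lemma tangential_mult (r : R) (f g : R3 -> R) (Tf Tg : axis -> R3 -> R) :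
  tangential r f Tf -> tangential r g Tg ->
  tangential r (fun x => f x * g x) (fun i x => f x * Tg i x + Tf i x * g x).
Proof.
  intros [cf cTf nf hf] [cg cTg ng hg]; split.
  - apply sph_cont_mult; assumption.
  - intros i; apply sph_cont_plus; apply sph_cont_mult; auto.
  - intros x hx; specialize (nf x hx); specialize (ng x hx); unfold sum3 in *.
    transitivity (f x * (coord Ax1 x * Tg Ax1 x + coord Ax2 x * Tg Ax2 x + coord Ax3 x * Tg Ax3 x)
      + g x * (coord Ax1 x * Tf Ax1 x + coord Ax2 x * Tf Ax2 x + coord Ax3 x * Tf Ax3 x)); [ring|].
    rewrite nf, ng; ring.
  - intros c1 c2 c3 t d1 d2 d3 x h1 h2 h3 hx ht.
    specialize (hf c1 c2 c3 t d1 d2 d3 h1 h2 h3 hx ht).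
    specialize (hg c1 c2 c3 t d1 d2 d3 h1 h2 h3 hx ht).
    evar_last; [apply (is_derive_mult (fun u => f (c1 u, c2 u, c3 u))
      (fun u => g (c1 u, c2 u, c3 u)) _ _ _ hf hg); intros; apply Rmult_comm|].
    unfold x, dotr, sum3, plus, mult; simpl; unfold mult; simpl; ring.
Qed.

Lemma tg_derive_polar (r : R) (f : R3 -> R) (Tf : axis -> R3 -> R) (s t : R) :
  tangential r f Tf ->
  is_derive (fun u => f (sphere_point r u t)) s
    (dotr (Tf Ax1 (sphere_point r s t), Tf Ax2 (sphere_point r s t), Tf Ax3 (sphere_point r s t))
       (r * (cos s * cos t), r * (cos s * sin t), - (r * sin s))).
Proof.
  intros hf; apply (tg_chain _ _ _ hf (fun u => r * (sin u * cos t)) (fun u => r * (sin u * sin t))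
           (fun u => r * cos u)).
  - auto_derive; [trivial | ring].
  - auto_derive; [trivial | ring].
  - auto_derive; [trivial | ring].
  - apply (sphere_point_on_sphere r s t).
  - unfold dotr, sum3; simpl.
    pose proof (sin2_cos2 t) as e; unfold Rsqr in e.
    transitivity (r * r * sin s * cos s * (sin t * sin t + cos t * cos t - 1)); [ring|].
    rewrite e; ring.
Qed.

Lemma tg_derive_azimuth (r : R) (f : R3 -> R) (Tf : axis -> R3 -> R) (s t : R) :
  tangential r f Tf ->
  is_derive (fun u => f (sphere_point r s u)) t
    (dotr (Tf Ax1 (sphere_point r s t), Tf Ax2 (sphere_point r s t), Tf Ax3 (sphere_point r s t))
       (- (r * (sin s * sin t)), r * (sin s * cos t), 0)).
Proof.
  intros hf; apply (tg_chain _ _ _ hf (fun u => r * (sin s * cos u)) (fun u => r * (sin s * sin u))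
           (fun u => r * cos s)).
  - auto_derive; [trivial | ring].
  - auto_derive; [trivial | ring].
  - auto_derive; [trivial | ring].
  - apply (sphere_point_on_sphere r s t).
  - unfold dotr, sum3; simpl; ring.
Qed.

Ltac cont2_trig :=
  repeat first [apply cont2_plus | apply cont2_mult | apply cont2_const
               | apply (cont2_fst sin), continuity_sin
               | apply (cont2_fst cos), continuity_cos
               | apply (cont2_snd sin), continuity_sin
               | apply (cont2_snd cos), continuity_cos | assumption].

(* In spherical coordinates, sin(polar) times a tangential derivative is, up to
   the curvature term, a sum of a polar derivative vanishing at both poles and
   an azimuthal derivative of a periodic function, with no singular coefficient. *)
Lemma sint_grad (r : R) (f : R3 -> R) (Tf : axis -> R3 -> R) (i : axis) :
  0 < r -> tangential r f Tf ->
  sint r (Tf i) = 2 / r ^ 2 * sint r (fun x => coord i x * f x).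
Proof.
  intros hr hf.
  set (F := fun s t => f (sphere_point r s t)).
  set (T := fun j s t => Tf j (sphere_point r s t)).
  set (Fs := fun s t => T Ax1 s t * (r * (cos s * cos t)) + T Ax2 s t * (r * (cos s * sin t))
                        + T Ax3 s t * (- r * sin s)).
  set (Ft := fun s t => T Ax1 s t * (- r * (sin s * sin t)) + T Ax2 s t * (r * (sin s * cos t))).
  assert (cF : cont2 F) by apply (tg_cont _ _ _ hf).
  assert (cT : forall j, cont2 (T j)) by (intros j; apply (tg_cont_grad _ _ _ hf)).
  assert (cT1 := cT Ax1); assert (cT2 := cT Ax2); assert (cT3 := cT Ax3).
  assert (cFs : cont2 Fs) by (unfold Fs; cont2_trig).
  assert (cFt : cont2 Ft) by (unfold Ft; cont2_trig).
  assert (dFs : forall s t, is_derive (fun u => F u t) s (Fs s t)).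
  { intros s t; evar_last; [apply (tg_derive_polar r f Tf s t hf)|].
    unfold Fs, dotr, sum3, T; simpl; ring. }
  assert (dFt : forall s t, is_derive (fun u => F s u) t (Ft s t)).
  { intros s t; evar_last; [apply (tg_derive_azimuth r f Tf s t hf)|].
    unfold Ft, dotr, sum3, T; simpl; ring. }
  assert (uFs : forall s t : R, Derive (fun u : R => F u t) s = Fs s t)
    by (intros; apply is_derive_unique, dFs).
  assert (uFt : forall s t : R, Derive (fun u : R => F s u) t = Ft s t)
    by (intros; apply is_derive_unique, dFt).
  (* [Fs] and [Ft] see only two components of the gradient; the vanishing radial one makes it
     possible to recover the Cartesian components. *)
  assert (nT : forall s t, sin s * cos t * T Ax1 s t + sin s * sin t * T Ax2 s t
                           + cos s * T Ax3 s t = 0).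
  { intros s t.
    pose proof (tg_normal _ _ _ hf _ (sphere_point_on_sphere r s t)) as n.
    unfold sum3 in n; simpl in n; fold (T Ax1 s t) (T Ax2 s t) (T Ax3 s t) in n.
    apply Rmult_eq_reg_l with r; [|lra]; rewrite Rmult_0_r, <- n; unfold T; ring. }
  assert (ss : forall s, sin s * sin s + cos s * cos s = 1).
  { intros s; apply (sin2_cos2 s). }
  assert (hX : sph_cont r (fun x => coord i x * f x)).
  { apply sph_cont_mult; [apply sph_cont_coord | exact cF]. }
  assert (split_density : forall A B DA DB : R -> R -> R,
    cont2 A -> cont2 DA -> cont2 DB ->
    (forall s t, is_derive (fun u => A u t) s (DA s t)) ->
    (forall s t, is_derive (B s) t (DB s t)) ->
    (forall t, A 0 t = 0) -> (forall t, A PI t = 0) ->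
    (forall s, B s (2 * PI) = B s 0) ->
    (forall s t, r ^ 2 * sin s * T i s t =
       DA s t + DB s t + 2 * (sin s * (coord i (sphere_point r s t) * F s t))) ->
    sint r (Tf i) = 2 / r ^ 2 * sint r (fun x => coord i x * f x)).
  { intros A B DA DB cA cDA cDB dA dB A0 Api Bper e.
    rewrite <- sint_scal by exact hX.
    unfold sint.
    rewrite (dint_ext _ (fun s t => (DA s t + DB s t)
       + r ^ 2 * sin s * (2 / r ^ 2 * (coord i (sphere_point r s t) * f (sphere_point r s t))))).
    - rewrite (dint_plus (fun s t => DA s t + DB s t)).
      + rewrite dint_plus by assumption.
        rewrite (dint_derive_fst A DA) by assumption.
        rewrite (dint_derive_snd B DB) by assumption.
        ring.
      + apply cont2_plus; assumption.
      + apply (cont2_density r (fun x => 2 / r ^ 2 * (coord i x * f x))).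
        apply sph_cont_mult; [apply sph_cont_const | exact hX].
    - intros s t _; fold (T i s t); rewrite e; unfold F; field; lra. }
  destruct i.
  (* For each axis, A is r F sin s times the component of the axis along the unit polar vector, and
     B is r F times its component along the unit azimuthal vector: the sin s of the area density has
     cancelled the 1 / sin s of the azimuthal derivative. *)
  - apply (split_density
      (fun s t => r * (sin s * cos s * cos t * F s t))
      (fun s t => - r * (sin t * F s t))
      (fun s t => r * ((cos s * cos s + -1 * (sin s * sin s)) * cos t * F s t
                       + sin s * cos s * cos t * Fs s t))
      (fun s t => - r * (cos t * F s t + sin t * Ft s t))).
    + cont2_trig.
    + cont2_trig.
    + cont2_trig.
    + intros s t; auto_derive; [eexists; apply dFs|].
      rewrite uFs; ring.
    + intros s t; auto_derive; [eexists; apply dFt|].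
      rewrite uFt; ring.
    + intros t; rewrite sin_0; ring.
    + intros t; rewrite sin_PI; ring.
    + intros s; rewrite sin_2PI, sin_0; ring.
    + intros s t; simpl coord; unfold Fs, Ft.
      pose proof (nT s t); pose proof (ss s); pose proof (ss t).
      revert H H0 H1; generalize (sin s) (cos s) (sin t) (cos t) (T Ax1 s t) (T Ax2 s t) (T Ax3 s t) (F s t).
      intros; simpl pow; nsatz.
  - apply (split_density
      (fun s t => r * (sin s * cos s * sin t * F s t))
      (fun s t => r * (cos t * F s t))
      (fun s t => r * ((cos s * cos s + -1 * (sin s * sin s)) * sin t * F s t
                       + sin s * cos s * sin t * Fs s t))
      (fun s t => r * (-1 * sin t * F s t + cos t * Ft s t))).
    + cont2_trig.
    + cont2_trig.
    + cont2_trig.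
    + intros s t; auto_derive; [eexists; apply dFs|].
      rewrite uFs; ring.
    + intros s t; auto_derive; [eexists; apply dFt|].
      rewrite uFt; ring.
    + intros t; rewrite sin_0; ring.
    + intros t; rewrite sin_PI; ring.
    + intros s. unfold F, sphere_point. rewrite !cos_2PI, !sin_2PI, cos_0, sin_0; ring.
    + intros s t; simpl coord; unfold Fs, Ft.
      pose proof (nT s t); pose proof (ss s); pose proof (ss t).
      revert H H0 H1; generalize (sin s) (cos s) (sin t) (cos t) (T Ax1 s t) (T Ax2 s t) (T Ax3 s t) (F s t).
      intros; simpl pow; nsatz.
  - apply (split_density
      (fun s t => - r * (sin s * sin s * F s t))
      (fun s t => 0)
      (fun s t => - r * (2 * (sin s * cos s) * F s t + sin s * sin s * Fs s t))
      (fun s t => 0)).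
    + cont2_trig.
    + cont2_trig.
    + apply cont2_const.
    + intros s t; auto_derive; [eexists; apply dFs|].
      rewrite uFs; ring.
    + intros s t; apply (is_derive_const (V := R_NormedModule)).
    + intros t; rewrite sin_0; ring.
    + intros t; rewrite sin_PI; ring.
    + reflexivity.
    + intros s t; simpl coord; unfold Fs, Ft.
      pose proof (nT s t); pose proof (ss s); pose proof (ss t).
      revert H H0 H1; generalize (sin s) (cos s) (sin t) (cos t) (T Ax1 s t) (T Ax2 s t) (T Ax3 s t) (F s t).
      intros; simpl pow; nsatz.
Qed.

(** Summing [sint_grad] over the axes leaves only the curvature term, 2 / r^2 times the integral of
    x.V, which is zero for a tangent field. *)
Lemma sint_divergence (r : R) (V : axis -> R3 -> R) (TV : axis -> axis -> R3 -> R) :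
  0 < r -> (forall k, tangential r (V k) (TV k)) ->
  (forall x, on_sphere r x -> sum3 (fun k => coord k x * V k x) = 0) ->
  sint r (fun x => sum3 (fun k => TV k k x)) = 0.
Proof.
  intros hr hV nV.
  rewrite sint_sum3 by (intros k; apply (tg_cont_grad _ _ _ (hV k))).
  assert (c : forall k, sph_cont r (fun x => coord k x * V k x)).
  { intros k; apply sph_cont_mult; [apply sph_cont_coord | apply (tg_cont _ _ _ (hV k))]. }
  transitivity (2 / r ^ 2 * sum3 (fun k => sint r (fun x => coord k x * V k x))).
  - unfold sum3; rewrite !(fun k => sint_grad r (V k) (TV k) k hr (hV k)); ring.
  - rewrite <- (sint_sum3 r (fun k x => coord k x * V k x)) by exact c.
    rewrite (sint_ext r _ (fun _ => 0)) by exact nV.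
    rewrite sint_const; ring.
Qed.

(** The divergence theorem for the tangent field f grad g; the trace of [TTg] is the Laplacian of
    g. *)
Lemma sint_by_parts (r : R) (f g : R3 -> R) (Tf Tg : axis -> R3 -> R)
    (TTg : axis -> axis -> R3 -> R) :
  0 < r -> tangential r f Tf -> tangential r g Tg ->
  (forall k, tangential r (Tg k) (TTg k)) ->
  sint r (fun x => f x * sum3 (fun k => TTg k k x))
  = - sint r (fun x => sum3 (fun k => Tf k x * Tg k x)).
Proof.
  intros hr hf hg hTg.
  assert (e := sint_divergence r (fun k x => f x * Tg k x)
                 (fun k j x => f x * TTg k j x + Tf j x * Tg k x) hr
                 (fun k => tangential_mult _ _ _ _ _ hf (hTg k))).
  assert (cTf := tg_cont_grad _ _ _ hf); assert (cTg := tg_cont_grad _ _ _ hg).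
  assert (cTTg := fun k => tg_cont_grad _ _ _ (hTg k) k).
  assert (cf := tg_cont _ _ _ hf).
  assert (c1 : sph_cont r (fun x => f x * sum3 (fun k => TTg k k x))).
  { apply sph_cont_mult, (sph_cont_sum3 r (fun k x => TTg k k x)); assumption. }
  assert (c2 : sph_cont r (fun x => sum3 (fun k => Tf k x * Tg k x))).
  { apply (sph_cont_sum3 r (fun k x => Tf k x * Tg k x)).
    intros k; apply sph_cont_mult; auto. }
  apply Rplus_opp_r_uniq; rewrite Rplus_comm, <- sint_plus by assumption.
  rewrite <- e.
  - apply sint_ext; intros x _; unfold sum3; ring.
  - intros x hx; assert (n := tg_normal _ _ _ hg x hx); unfold sum3 in *.
    transitivity (f x * (coord Ax1 x * Tg Ax1 x + coord Ax2 x * Tg Ax2 x + coord Ax3 x * Tg Ax3 x));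
      [ring | rewrite n; ring].
Qed.

(** * Polynomials in the coordinates and the inverse distance *)

(* The functions of a point x of the sphere generated by its coordinates and
   by 1 / |x - z|, with the coordinates of z and p as parameters. *)
Inductive sexpr : Type :=
| ECst (c : R)
| EX (i : axis)
| EZ (i : axis)
| EP (i : axis)
| EInv
| EAdd (e1 e2 : sexpr)
| EMul (e1 e2 : sexpr).

(* Equals |x - z|^2 when |x| = r. *)
Definition sqdist (r : R) (z x : R3) : R := r ^ 2 + dotr z z - 2 * dotr x z.

Fixpoint ev (r : R) (z p : R3) (e : sexpr) (x : R3) : R :=
  match e with
  | ECst c => c
  | EX i => coord i x
  | EZ i => coord i z
  | EP i => coord i p
  | EInv => / sqrt (sqdist r z x)
  | EAdd e1 e2 => ev r z p e1 x + ev r z p e2 x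
  | EMul e1 e2 => ev r z p e1 x * ev r z p e2 x
  end.

Definition sumE (F : axis -> sexpr) : sexpr := EAdd (EAdd (F Ax1) (F Ax2)) (F Ax3).

(** The height x.z. It enters the derivative of [EInv], and its gradient, the tangential part of z,
    is the zonal field used for the moments and for the Poincare inequality. *)
Definition XZ : sexpr := sumE (fun i => EMul (EX i) (EZ i)).

(** The rule for [EX] is the projection onto the tangent plane. That for [EInv] is u^3 times the
    tangential part of z, because the squared distance is affine in x on the sphere. *)
Fixpoint diff (r : R) (k : axis) (e : sexpr) : sexpr :=
  match e with
  | ECst _ | EZ _ | EP _ => ECst 0
  | EX i => EAdd (ECst (kron i k)) (EMul (ECst (- / r ^ 2)) (EMul (EX i) (EX k)))
  | EInv => EMul (EMul EInv (EMul EInv EInv))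
                   (EAdd (EZ k) (EMul (ECst (- / r ^ 2)) (EMul (EX k) XZ)))
  | EAdd e1 e2 => EAdd (diff r k e1) (diff r k e2)
  | EMul e1 e2 => EAdd (EMul e1 (diff r k e2)) (EMul (diff r k e1) e2)
  end.

Definition lapE (r : R) (e : sexpr) : sexpr :=
  EMul (ECst (-1)) (sumE (fun k => diff r k (diff r k e))).

Lemma dotr_cauchy (x y : R3) : dotr x y ^ 2 <= dotr x x * dotr y y.
Proof.
  unfold dotr, sum3.
  set (a := coord Ax1 x); set (b := coord Ax2 x); set (c := coord Ax3 x).
  set (d := coord Ax1 y); set (e := coord Ax2 y); set (f := coord Ax3 y).
  pose proof (pow2_ge_0 (a * e - b * d)); pose proof (pow2_ge_0 (a * f - c * d));
  pose proof (pow2_ge_0 (b * f - c * e)); nra.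
Qed.

Lemma dotr_le (x y : R3) : Rabs (dotr x y) <= norm3 x * norm3 y.
Proof.
  apply Rsqr_incr_0_var.
  - rewrite <- Rsqr_abs, !Rsqr_pow2, Rpow_mult_distr, !norm3_sqr; apply dotr_cauchy.
  - apply Rmult_le_pos; apply norm3_pos.
Qed.

Lemma sqdist_ge (r : R) (z x : R3) :
  0 < r -> on_sphere r x -> (r - norm3 z) ^ 2 <= sqdist r z x.
Proof.
  intros hr hx; unfold sqdist; rewrite <- (norm3_sqr z).
  assert (h := dotr_le x z); rewrite (on_sphere_norm3 r x hr hx) in h.
  apply Rabs_le_between in h; nra.
Qed.

Lemma sqdist_pos (r : R) (z x : R3) :
  0 < r -> in_ball r z -> on_sphere r x -> 0 < sqdist r z x.
Proof.
  intros hr hz hx; eapply Rlt_le_trans; [|apply (sqdist_ge r z x hr hx)].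
  unfold in_ball in hz; nra.
Qed.

Lemma ev_cont (r : R) (z p : R3) (e : sexpr) :
  0 < r -> in_ball r z -> sph_cont r (ev r z p e).
Proof.
  intros hr hz; induction e; simpl;
    auto using sph_cont_const, sph_cont_coord, sph_cont_plus, sph_cont_mult.
  intros s t.
  apply (continuity_1d_2d_pt_comp (fun w => / sqrt w)
           (fun s t => sqdist r z (sphere_point r s t))).
  - assert (h := sqdist_pos r z _ hr hz (sphere_point_on_sphere r s t)).
    apply continuity_pt_inv.
    + apply continuity_pt_sqrt; lra.
    + apply Rgt_not_eq, sqrt_lt_R0, h.
  - revert s t; change (sph_cont r (sqdist r z)); unfold sqdist.
    apply (sph_cont_ext r (fun x => (r ^ 2 + dotr z z) + -2 * dotr x z));
      [intros; ring|].
    apply sph_cont_plus; [apply sph_cont_const|].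
    apply sph_cont_mult; [apply sph_cont_const|].
    apply (sph_cont_sum3 r (fun i x => coord i x * coord i z)).
    intros i; apply sph_cont_mult; [apply sph_cont_coord | apply sph_cont_const].
Qed.

Lemma ev_normal (r : R) (z p : R3) (e : sexpr) (x : R3) :
  0 < r -> on_sphere r x ->
  sum3 (fun k => coord k x * ev r z p (diff r k e) x) = 0.
Proof.
  intros hr hx; unfold on_sphere, dotr, sum3 in hx.
  unfold sum3; induction e; cbn [ev diff]; try ring.
  - set (a := coord Ax1 x) in *; set (b := coord Ax2 x) in *; set (c := coord Ax3 x) in *.
    assert (hr2 : / r ^ 2 * (a * a + b * b + c * c) = 1) by (rewrite hx; field; lra).
    destruct i; cbn [coord kron]; fold (coord Ax1 x) (coord Ax2 x) (coord Ax3 x);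
      fold a b c; simpl kron.
    + transitivity (a * (1 - / r ^ 2 * (a * a + b * b + c * c))); [ring | rewrite hr2; ring].
    + transitivity (b * (1 - / r ^ 2 * (a * a + b * b + c * c))); [ring | rewrite hr2; ring].
    + transitivity (c * (1 - / r ^ 2 * (a * a + b * b + c * c))); [ring | rewrite hr2; ring].
  - unfold XZ, sumE; cbn [ev].
    set (u := / sqrt (sqdist r z x)).
    set (a := coord Ax1 x) in *; set (b := coord Ax2 x) in *; set (c := coord Ax3 x) in *.
    assert (hr2 : / r ^ 2 * (a * a + b * b + c * c) = 1) by (rewrite hx; field; lra).
    transitivity (u * (u * u) * (a * coord Ax1 z + b * coord Ax2 z + c * coord Ax3 z)
      * (1 - / r ^ 2 * (a * a + b * b + c * c))); [ring | rewrite hr2; ring].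
  - lra.
  - match goal with |- ?l = 0 => transitivity
      (ev r z p e1 x * (coord Ax1 x * ev r z p (diff r Ax1 e2) x
         + coord Ax2 x * ev r z p (diff r Ax2 e2) x + coord Ax3 x * ev r z p (diff r Ax3 e2) x)
       + ev r z p e2 x * (coord Ax1 x * ev r z p (diff r Ax1 e1) x
         + coord Ax2 x * ev r z p (diff r Ax2 e1) x + coord Ax3 x * ev r z p (diff r Ax3 e1) x))
    end; [ring | rewrite IHe1, IHe2; ring].
Qed.

(** The projection terms of [diff] all carry the factor x.d, which vanishes for a tangent velocity
    d, so the ordinary chain rule remains. *)
Lemma ev_chain (r : R) (z p : R3) (e : sexpr) (c1 c2 c3 : R -> R) (t d1 d2 d3 : R) :
  0 < r -> in_ball r z ->
  is_derive c1 t d1 -> is_derive c2 t d2 -> is_derive c3 t d3 ->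
  let x := (c1 t, c2 t, c3 t) in
  on_sphere r x -> dotr x (d1, d2, d3) = 0 ->
  is_derive (fun u => ev r z p e (c1 u, c2 u, c3 u)) t
    (dotr (ev r z p (diff r Ax1 e) x, ev r z p (diff r Ax2 e) x, ev r z p (diff r Ax3 e) x)
       (d1, d2, d3)).
Proof.
  intros hr hz h1 h2 h3 x hx ht.
  unfold x, dotr, sum3 in ht; unfold dotr, sum3; cbn [coord fst snd] in ht |- *.
  assert (const : forall c : R, is_derive (fun _ : R => c) t (0 * d1 + 0 * d2 + 0 * d3)).
  { intros c; evar_last; [apply (is_derive_const (V := R_NormedModule))|].
    unfold zero; simpl; ring. }
  induction e; cbn [ev diff].
  - apply const.
  - assert (n : forall y, - / r ^ 2 * (y * c1 t) * d1 + - / r ^ 2 * (y * c2 t) * d2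
                  + - / r ^ 2 * (y * c3 t) * d3 = 0).
    { intros y; transitivity (- / r ^ 2 * y * (c1 t * d1 + c2 t * d2 + c3 t * d3));
        [ring | rewrite ht; ring]. }
    destruct i; unfold x; cbn [coord]; cbn [fst snd].
    + evar_last; [exact h1|]; specialize (n (c1 t)); simpl kron; lra.
    + evar_last; [exact h2|]; specialize (n (c2 t)); simpl kron; lra.
    + evar_last; [exact h3|]; specialize (n (c3 t)); simpl kron; lra.
  - apply const.
  - apply const.
  - assert (hw := sqdist_pos r z x hr hz hx).
    unfold XZ, sumE; cbn [ev].
    set (w := fun u => sqdist r z (c1 u, c2 u, c3 u)).
    assert (dw : is_derive w t (-2 * (coord Ax1 z * d1 + coord Ax2 z * d2 + coord Ax3 z * d3))).
    { unfold w, sqdist, dotr, sum3; cbn [coord fst snd].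
      auto_derive; [repeat split; eexists; eassumption|].
      assert (e1 : Derive (fun u : R => c1 u) t = d1) by (apply is_derive_unique, h1).
      assert (e2 : Derive (fun u : R => c2 u) t = d2) by (apply is_derive_unique, h2).
      assert (e3 : Derive (fun u : R => c3 u) t = d3) by (apply is_derive_unique, h3).
      rewrite e1, e2, e3; ring. }
    assert (du : is_derive (fun v => / sqrt v) (w t) (- / (2 * (sqrt (w t)) ^ 3))).
    { assert (0 < sqrt (w t)) by (apply sqrt_lt_R0; exact hw).
      auto_derive; [repeat split; [exact hw | lra]|]; field; lra. }
    evar_last; [apply (is_derive_comp (fun v => / sqrt v) w t _ _ du dw)|].
    unfold scal; simpl; unfold mult; simpl; fold x.
    change (sqdist r z x) with (w t).
    assert (0 < sqrt (w t)) by (apply sqrt_lt_R0; exact hw).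
    set (q := sqrt (w t)) in *.
    transitivity (/ q * (/ q * / q) * ((coord Ax1 z * d1 + coord Ax2 z * d2 + coord Ax3 z * d3)
      - / r ^ 2 * (c1 t * coord Ax1 z + c2 t * coord Ax2 z + c3 t * coord Ax3 z)
        * (c1 t * d1 + c2 t * d2 + c3 t * d3))).
    + rewrite ht; unfold coord; field; lra.
    + unfold coord; simpl; field; lra.
  - evar_last; [apply (is_derive_plus _ _ _ _ _ IHe1 IHe2)|].
    unfold plus; simpl; ring.
  - evar_last; [apply (is_derive_mult _ _ _ _ _ IHe1 IHe2); intros; apply Rmult_comm|].
    unfold plus, mult; simpl; fold x; ring.
Qed.

Lemma ev_tangential (r : R) (z p : R3) (e : sexpr) :
  0 < r -> in_ball r z ->
  tangential r (ev r z p e) (fun k => ev r z p (diff r k e)).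
Proof.
  intros hr hz; split.
  - apply ev_cont; assumption.
  - intros; apply ev_cont; assumption.
  - intros; apply ev_normal; assumption.
  - intros; apply ev_chain; assumption.
Qed.

(** The two factors keep separate parameters so that a dipole at y can be paired with one at z. *)
Lemma sint_lapE (r : R) (z p z' p' : R3) (e e' : sexpr) :
  0 < r -> in_ball r z -> in_ball r z' ->
  sint r (fun x => ev r z p e x * ev r z' p' (lapE r e') x)
  = sint r (fun x => sum3 (fun k => ev r z p (diff r k e) x * ev r z' p' (diff r k e') x)).
Proof.
  intros hr hz hz'.
  assert (E := sint_by_parts r _ _ _ _ (fun k j => ev r z' p' (diff r j (diff r k e'))) hr
    (ev_tangential r z p e hr hz) (ev_tangential r z' p' e' hr hz')
    (fun k => ev_tangential r z' p' (diff r k e') hr hz')).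
  rewrite <- (Ropp_involutive (sint r (fun x => sum3 _))), <- E.
  assert (c : sph_cont r (fun x => ev r z p e x
    * sum3 (fun k => ev r z' p' (diff r k (diff r k e')) x))).
  { apply sph_cont_mult; [apply ev_cont; assumption|].
    apply (sph_cont_sum3 r (fun k => ev r z' p' (diff r k (diff r k e')))).
    intros; apply ev_cont; assumption. }
  transitivity (-1 * sint r (fun x => ev r z p e x
    * sum3 (fun k => ev r z' p' (diff r k (diff r k e')) x))); [|ring].
  rewrite <- sint_scal by exact c.
  apply sint_ext; intros; unfold lapE, sumE, sum3; cbn [ev]; ring.
Qed.

Lemma sint_lapE_sym (r : R) (z p z' p' : R3) (e e' : sexpr) :
  0 < r -> in_ball r z -> in_ball r z' ->
  sint r (fun x => ev r z p e x * ev r z' p' (lapE r e') x)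
  = sint r (fun x => ev r z p (lapE r e) x * ev r z' p' e' x).
Proof.
  intros hr hz hz'.
  rewrite sint_lapE by assumption.
  rewrite (sint_ext r (fun x => ev r z p (lapE r e) x * ev r z' p' e' x)
             (fun x => ev r z' p' e' x * ev r z p (lapE r e) x)) by (intros; ring).
  rewrite sint_lapE by assumption.
  apply sint_ext; intros; unfold sum3; ring.
Qed.

(** Used twice: to move all the Laplacians of the numerator onto the fixed field, which stays
    smooth, and to share those of the denominator equally between the two factors. *)
Lemma sint_iter_lapE (r : R) (z p z' p' : R3) (n : nat) (e e' : sexpr) :
  0 < r -> in_ball r z -> in_ball r z' ->
  sint r (fun x => ev r z p e x * ev r z' p' (Nat.iter n (lapE r) e') x)
  = sint r (fun x => ev r z p (Nat.iter n (lapE r) e) x * ev r z' p' e' x).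
Proof.
  intros hr hz hz'; revert e; induction n as [|n IH]; intros e; [reflexivity|].
  rewrite (Nat.iter_succ_r n sexpr (lapE r) e), <- IH.
  exact (sint_lapE_sym r z p z' p' e _ hr hz hz').
Qed.

(** * The surface operators on the dipole field *)

Lemma surf_int_pair (r : R) (f : R3 -> C) (g h : R3 -> R) :
  sph_cont r g -> sph_cont r h ->
  (forall x, on_sphere r x -> f x = (g x, h x)) ->
  surf_int r f = (sint r g, sint r h).
Proof.
  intros cg ch e.
  apply cont2_density in cg; apply cont2_density in ch.
  unfold surf_int; apply (is_RInt_unique (V := C_R_CompleteNormedModule)).
  apply (is_RInt_ext (V := C_R_NormedModule) (fun s =>
    (RInt (fun t => r ^ 2 * sin s * g (sphere_point r s t)) 0 (2 * PI),
     RInt (fun t => r ^ 2 * sin s * h (sphere_point r s t)) 0 (2 * PI)) : C)).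
  - intros s _; symmetry; apply (is_RInt_unique (V := C_R_CompleteNormedModule)).
    apply (is_RInt_ext (V := C_R_NormedModule) (fun t =>
      (r ^ 2 * sin s * g (sphere_point r s t), r ^ 2 * sin s * h (sphere_point r s t)) : C)).
    + intros t _; rewrite e by apply sphere_point_on_sphere.
      unfold Cmult, RtoC; simpl; f_equal; ring.
    + apply (is_RInt_fct_extend_pair (U := R_NormedModule) (V := R_NormedModule)); cbn [fst snd];
        apply (RInt_correct (V := R_CompleteNormedModule)).
      * apply (cont2_ex_RInt _ s 0 (2 * PI) cg).
      * apply (cont2_ex_RInt _ s 0 (2 * PI) ch).
  - apply (is_RInt_fct_extend_pair (U := R_NormedModule) (V := R_NormedModule)); cbn [fst snd];
      apply (RInt_correct (V := R_CompleteNormedModule)).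
    + apply (dint_ex_outer _ 0 PI cg).
    + apply (dint_ex_outer _ 0 PI ch).
Qed.

Lemma proj_sphere_on_sphere (r : R) (x : R3) :
  0 < dotr x x -> on_sphere r (proj_sphere r x).
Proof.
  intros hx; unfold on_sphere, proj_sphere.
  rewrite norm3_dotr.
  assert (h : sqrt (dotr x x) * sqrt (dotr x x) = dotr x x) by (apply sqrt_sqrt; lra).
  assert (0 < sqrt (dotr x x)) by (apply sqrt_lt_R0; exact hx).
  transitivity ((r / sqrt (dotr x x)) ^ 2 * dotr x x).
  - generalize (r / sqrt (dotr x x)); intros c.
    destruct x as [[x1 x2] x3]; unfold dotr, sum3; simpl; ring.
  - rewrite <- h at 2; field; lra.
Qed.

(** The projected curve has as velocity the tangential part of d. The radial part thus removed is
    orthogonal to the tangential gradient by [ev_normal], so d itself may stand in the result. *)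
Lemma derive_proj_sphere (r : R) (z p : R3) (e : sexpr) (g : R3 -> R)
    (w1 w2 w3 : R -> R) (t d1 d2 d3 : R) :
  0 < r -> in_ball r z ->
  (forall x, on_sphere r x -> g x = ev r z p e x) ->
  is_derive w1 t d1 -> is_derive w2 t d2 -> is_derive w3 t d3 ->
  let x := (w1 t, w2 t, w3 t) in
  on_sphere r x ->
  Derive (fun u => g (proj_sphere r (w1 u, w2 u, w3 u))) t
  = dotr (ev r z p (diff r Ax1 e) x, ev r z p (diff r Ax2 e) x, ev r z p (diff r Ax3 e) x)
      (d1, d2, d3).
Proof.
  intros hr hz hg h1 h2 h3 x hx.
  assert (E1 : Derive (fun u : R => w1 u) t = d1) by (apply is_derive_unique, h1).
  assert (E2 : Derive (fun u : R => w2 u) t = d2) by (apply is_derive_unique, h2).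
  assert (E3 : Derive (fun u : R => w3 u) t = d3) by (apply is_derive_unique, h3).
  set (N := fun u => w1 u ^ 2 + w2 u ^ 2 + w3 u ^ 2).
  assert (Nt : N t = r ^ 2).
  { unfold N; unfold on_sphere, x, dotr, sum3 in hx; cbn [coord fst snd] in hx.
    rewrite <- hx; ring. }
  assert (Npos : 0 < N t) by (rewrite Nt; apply pow_lt; exact hr).
  assert (sN : sqrt (N t) = r) by (rewrite Nt; apply sqrt_pow2; lra).
  set (s := w1 t * d1 + w2 t * d2 + w3 t * d3).
  assert (dN : is_derive N t (2 * s)).
  { unfold N, s; auto_derive; [repeat split; eexists; eassumption|].
    rewrite E1, E2, E3; ring. }
  assert (dq : is_derive (fun u => r / sqrt (N u)) t (- s / r ^ 2)).
  { auto_derive.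
    - repeat split; [eexists; exact dN | exact Npos | rewrite sN; lra].
    - assert (EN : Derive (fun u : R => N u) t = 2 * s) by (apply is_derive_unique, dN).
      rewrite EN, sN; field; lra. }
  assert (dc : forall w d, is_derive w t d ->
    is_derive (fun u => r / sqrt (N u) * w u) t (d - w t * s / r ^ 2)).
  { intros w d hw.
    evar_last; [apply (is_derive_mult _ _ _ _ _ dq hw); intros; apply Rmult_comm|].
    unfold plus, mult; simpl; rewrite sN; field; lra. }
  assert (cx : forall y, r / sqrt (N t) * y = y) by (intros y; rewrite sN; field; lra).
  apply is_derive_unique.
  apply is_derive_ext_loc with (fun u =>
    ev r z p e (r / sqrt (N u) * w1 u, r / sqrt (N u) * w2 u, r / sqrt (N u) * w3 u)).
  (* [g] is known on the sphere only; the projection lands there as long as the curve avoids the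
     origin, hence for parameters near t. *)
  - assert (near : locally t (fun u => 0 < N u)).
    { apply (ex_derive_continuous (V := R_NormedModule) N t); [eexists; exact dN|].
      apply (open_gt 0), Npos. }
    revert near; apply filter_imp; intros u hu.
    symmetry; rewrite hg; [reflexivity|].
    apply proj_sphere_on_sphere; unfold dotr, sum3; cbn [coord fst snd].
    unfold N in hu; lra.
  - assert (n := ev_normal r z p e x hr hx).
    evar_last; [apply (ev_chain r z p e _ _ _ t _ _ _ hr hz (dc w1 d1 h1) (dc w2 d2 h2) (dc w3 d3 h3))|].
    + rewrite !cx; exact hx.
    + rewrite !cx; unfold on_sphere, x, dotr, sum3 in *; cbn [coord fst snd] in *.
      transitivity (s - (w1 t * w1 t + w2 t * w2 t + w3 t * w3 t) * s / r ^ 2);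
        [unfold s; field; lra | rewrite hx; field; lra].
    + rewrite !cx; fold x; unfold dotr, sum3 in *; cbn [coord fst snd] in *.
      unfold x in n; cbn [fst snd] in n; fold x in n.
      match goal with |- ?l = ?rr => transitivity
        (rr - s / r ^ 2 * (w1 t * ev r z p (diff r Ax1 e) x + w2 t * ev r z p (diff r Ax2 e) x
                        + w3 t * ev r z p (diff r Ax3 e) x)) end;
        [field; lra | rewrite n; ring].
Qed.

Definition ccoord (i : axis) (a : C3) : C :=
  match i with Ax1 => comp1 a | Ax2 => comp2 a | Ax3 => comp3 a end.

Definition re3 (a : C3) : R3 := (fst (comp1 a), fst (comp2 a), fst (comp3 a)).
Definition im3 (a : C3) : R3 := (snd (comp1 a), snd (comp2 a), snd (comp3 a)).

(** One expression serves both parts of a complex function: the gradient of the Green function is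
    real and the cross product linear, so only the parameter p changes, and the real surface
    operators preserve this form. *)
Definition cev (r : R) (z : R3) (b : C3) (e : sexpr) (x : R3) : C :=
  (ev r z (re3 b) e x, ev r z (im3 b) e x).

Lemma grad_proj_sphere (r : R) (z : R3) (b : C3) (e : sexpr) (f : R3 -> C) (x : R3) (k : axis) :
  0 < r -> in_ball r z ->
  (forall w, on_sphere r w -> f w = cev r z b e w) -> on_sphere r x ->
  ccoord k (grad (fun w => f (proj_sphere r w)) x) = cev r z b (diff r k e) x.
Proof.
  intros hr hz hf hx.
  assert (hre : forall w, on_sphere r w -> Re (f w) = ev r z (re3 b) e w)
    by (intros w hw; rewrite hf by exact hw; reflexivity).
  assert (him : forall w, on_sphere r w -> Im (f w) = ev r z (im3 b) e w)
    by (intros w hw; rewrite hf by exact hw; reflexivity).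
  destruct x as [[x1 x2] x3].
  assert (id : forall t, is_derive (fun u : R => u) t 1)
    by (intros; apply (is_derive_id (K := R_AbsRing))).
  assert (cst : forall c t : R, is_derive (fun _ : R => c) t 0)
    by (intros; apply (is_derive_const (V := R_NormedModule))).
  destruct k; unfold cev; cbn [ccoord grad comp1 comp2 comp3 fst snd]; unfold CDerive; f_equal.
  - rewrite (derive_proj_sphere r z (re3 b) e (fun w => Re (f w)) (fun u => u) (fun _ => x2) (fun _ => x3)
      x1 1 0 0 hr hz hre (id _) (cst _ _) (cst _ _) hx); unfold dotr, sum3; cbn [coord fst snd]; ring.
  - rewrite (derive_proj_sphere r z (im3 b) e (fun w => Im (f w)) (fun u => u) (fun _ => x2) (fun _ => x3)
      x1 1 0 0 hr hz him (id _) (cst _ _) (cst _ _) hx); unfold dotr, sum3; cbn [coord fst snd]; ring.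
  - rewrite (derive_proj_sphere r z (re3 b) e (fun w => Re (f w)) (fun _ => x1) (fun u => u) (fun _ => x3)
      x2 0 1 0 hr hz hre (cst _ _) (id _) (cst _ _) hx); unfold dotr, sum3; cbn [coord fst snd]; ring.
  - rewrite (derive_proj_sphere r z (im3 b) e (fun w => Im (f w)) (fun _ => x1) (fun u => u) (fun _ => x3)
      x2 0 1 0 hr hz him (cst _ _) (id _) (cst _ _) hx); unfold dotr, sum3; cbn [coord fst snd]; ring.
  - rewrite (derive_proj_sphere r z (re3 b) e (fun w => Re (f w)) (fun _ => x1) (fun _ => x2) (fun u => u)
      x3 0 0 1 hr hz hre (cst _ _) (cst _ _) (id _) hx); unfold dotr, sum3; cbn [coord fst snd]; ring.
  - rewrite (derive_proj_sphere r z (im3 b) e (fun w => Im (f w)) (fun _ => x1) (fun _ => x2) (fun u => u)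
      x3 0 0 1 hr hz him (cst _ _) (cst _ _) (id _) hx); unfold dotr, sum3; cbn [coord fst snd]; ring.
Qed.

(** The surface gradient is itself represented on the sphere by [diff], so [grad_proj_sphere]
    applies a second time and the divergence becomes a trace. *)
Lemma laplace_beltrami_cev (r : R) (z : R3) (b : C3) (e : sexpr) (f : R3 -> C) (x : R3) :
  0 < r -> in_ball r z ->
  (forall w, on_sphere r w -> f w = cev r z b e w) -> on_sphere r x ->
  (- laplace_beltrami r f x)%C = cev r z b (lapE r e) x.
Proof.
  intros hr hz hf hx.
  assert (hk : forall k, ccoord k (grad (fun w => ccoord k (surf_grad r f (proj_sphere r w))) x)
                 = cev r z b (diff r k (diff r k e)) x).
  { intros k; apply (grad_proj_sphere r z b (diff r k e) (fun w => ccoord k (surf_grad r f w)));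
      try assumption.
    intros w hw; apply grad_proj_sphere; assumption. }
  unfold laplace_beltrami, surf_div, divergence.
  assert (h1 := hk Ax1); assert (h2 := hk Ax2); assert (h3 := hk Ax3).
  cbn [ccoord] in h1, h2, h3; rewrite h1, h2, h3.
  unfold cev, lapE, sumE, Copp, Cplus; cbn [ev fst snd]; f_equal; ring.
Qed.

(** Agreement on the sphere alone is stable under the surface Laplacian, which composes with the
    projection before differentiating. *)
Definition represents (r : R) (z : R3) (b : C3) (E : axis -> sexpr) (v : R3 -> C3) : Prop :=
  forall x, on_sphere r x -> forall i, ccoord i (v x) = cev r z b (E i) x.

Lemma neg_lap3_pow_represents (r : R) (z : R3) (b : C3) (E : axis -> sexpr) (v : R3 -> C3) (n : nat) :
  0 < r -> in_ball r z -> represents r z b E v ->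
  represents r z b (fun i => Nat.iter n (lapE r) (E i)) (neg_lap3_pow r n v).
Proof.
  intros hr hz h; induction n as [|n IH]; [exact h|].
  intros x hx i; destruct i; unfold neg_lap3_pow; cbn [Nat.iter];
    fold (neg_lap3_pow r n v); unfold neg_lap3; cbn [ccoord comp1 comp2 comp3 fst snd].
  - apply laplace_beltrami_cev; try assumption; intros w hw; apply (IH w hw Ax1).
  - apply laplace_beltrami_cev; try assumption; intros w hw; apply (IH w hw Ax2).
  - apply laplace_beltrami_cev; try assumption; intros w hw; apply (IH w hw Ax3).
Qed.

Definition XmZ (i : axis) : sexpr := EAdd (EX i) (EMul (ECst (-1)) (EZ i)).

Definition crossE (i j : axis) : sexpr :=
  EAdd (EMul (XmZ i) (EP j)) (EMul (ECst (-1)) (EMul (XmZ j) (EP i))).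

Definition dipE (i : axis) : sexpr :=
  EMul (EMul (ECst (- / (4 * PI))) (EMul EInv (EMul EInv EInv)))
    match i with Ax1 => crossE Ax2 Ax3 | Ax2 => crossE Ax3 Ax1 | Ax3 => crossE Ax1 Ax2 end.

Lemma sqdist_sub3 (r : R) (z x : R3) :
  on_sphere r x -> sqdist r z x = dotr (sub3 x z) (sub3 x z).
Proof.
  unfold on_sphere, sqdist; intros <-.
  destruct x as [[x1 x2] x3], z as [[z1 z2] z3]; unfold dotr, sum3; simpl; ring.
Qed.

Lemma derive_green (w1 w2 w3 : R -> R) (z : R3) (t d1 d2 d3 : R) :
  is_derive w1 t d1 -> is_derive w2 t d2 -> is_derive w3 t d3 ->
  let v := sub3 (w1 t, w2 t, w3 t) z in
  0 < dotr v v ->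
  Derive (fun u => green (w1 u, w2 u, w3 u) z) t
  = - / (4 * PI) * (/ sqrt (dotr v v)) ^ 3 * dotr v (d1, d2, d3).
Proof.
  intros h1 h2 h3 v hv.
  assert (E1 : Derive (fun u : R => w1 u) t = d1) by (apply is_derive_unique, h1).
  assert (E2 : Derive (fun u : R => w2 u) t = d2) by (apply is_derive_unique, h2).
  assert (E3 : Derive (fun u : R => w3 u) t = d3) by (apply is_derive_unique, h3).
  set (N := fun u => dotr (sub3 (w1 u, w2 u, w3 u) z) (sub3 (w1 u, w2 u, w3 u) z)).
  assert (dN : is_derive N t (2 * dotr v (d1, d2, d3))).
  { unfold N, v; destruct z as [[z1 z2] z3]; unfold dotr, sum3; cbn [sub3 coord fst snd].
    auto_derive; [repeat split; eexists; eassumption|].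
    rewrite E1, E2, E3; ring. }
  assert (EN : Derive (fun u : R => N u) t = 2 * dotr v (d1, d2, d3))
    by (apply is_derive_unique, dN).
  assert (hN : 0 < N t) by exact hv.
  assert (0 < sqrt (N t)) by (apply sqrt_lt_R0; exact hN).
  assert (hPI := PI_RGT_0).
  apply is_derive_unique.
  apply (is_derive_ext (fun u => / (4 * PI * sqrt (N u)))).
  - intros u; unfold green; rewrite norm3_dotr; reflexivity.
  - auto_derive.
    + repeat split; [eexists; exact dN | exact hN | ].
      apply Rgt_not_eq; nra.
    + rewrite EN; change (dotr v v) with (N t); field; split; lra.
Qed.

Lemma dipole_represents (r : R) (z : R3) (b : C3) :
  0 < r -> in_ball r z -> represents r z b dipE (dipole z b).
Proof.
  intros hr hz x hx i.
  assert (hd := sqdist_pos r z x hr hz hx); rewrite sqdist_sub3 in hd by exact hx.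
  assert (id : forall t, is_derive (fun u : R => u) t 1)
    by (intros; apply (is_derive_id (K := R_AbsRing))).
  assert (cst : forall c t : R, is_derive (fun _ : R => c) t 0)
    by (intros; apply (is_derive_const (V := R_NormedModule))).
  assert (hs := sqdist_sub3 r z x hx).
  destruct x as [[x1 x2] x3], b as [[[b1 b1'] [b2 b2']] [b3 b3']].
  assert (c0 : forall t : R, Derive (fun _ : R => 0) t = 0) by (intros; apply Derive_const).
  unfold dipole; cbn [grad]; unfold CDerive; cbn [Re Im fst snd RtoC].
  rewrite !c0.
  rewrite (derive_green (fun u => u) (fun _ => x2) (fun _ => x3) z x1 1 0 0); auto.
  rewrite (derive_green (fun _ => x1) (fun u => u) (fun _ => x3) z x2 0 1 0); auto.
  rewrite (derive_green (fun _ => x1) (fun _ => x2) (fun u => u) z x3 0 0 1); auto.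
  rewrite <- hs.
  destruct z as [[z1 z2] z3].
  destruct i; unfold cev, dipE, crossE, XmZ; cbn [ccoord cross3 comp1 comp2 comp3 fst snd];
    unfold Cminus, Cplus, Copp, Cmult, dotr, sum3, re3, im3;
    cbn [ev coord fst snd sub3 comp1 comp2 comp3]; f_equal; ring.
Qed.

Lemma pairing_represents (r : R) (y z : R3) (a b : C3) (A B : axis -> sexpr) (v w : R3 -> C3) (n : nat) :
  0 < r -> in_ball r y -> in_ball r z ->
  represents r y a A v -> represents r z b B w ->
  let I p q := sum3 (fun i => sint r (fun x =>
    ev r y p (A i) x * ev r z q (Nat.iter n (lapE r) (B i)) x)) in
  pairing r n v w = (I (re3 a) (re3 b) + I (im3 a) (im3 b),
                     I (im3 a) (re3 b) - I (re3 a) (im3 b)).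
Proof.
  intros hr hy hz hv hw I.
  apply (neg_lap3_pow_represents r z b B w n hr hz) in hw.
  set (D := fun p q i x => ev r y p (A i) x * ev r z q (Nat.iter n (lapE r) (B i)) x).
  assert (cD : forall p q i, sph_cont r (D p q i))
    by (intros; apply sph_cont_mult; apply ev_cont; assumption).
  assert (cS : forall p q, sph_cont r (fun x => sum3 (fun i => D p q i x)))
    by (intros; apply (sph_cont_sum3 r (D p q)); auto).
  assert (eI : forall p q, I p q = sint r (fun x => sum3 (fun i => D p q i x)))
    by (intros; symmetry; apply (sint_sum3 r (D p q)); auto).
  unfold pairing.
  rewrite (surf_int_pair r _
    (fun x => sum3 (fun i => D (re3 a) (re3 b) i x) + sum3 (fun i => D (im3 a) (im3 b) i x))
    (fun x => sum3 (fun i => D (im3 a) (re3 b) i x) + -1 * sum3 (fun i => D (re3 a) (im3 b) i x))).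
  - rewrite !sint_plus, sint_scal, !eI by auto using sph_cont_mult, sph_cont_const.
    f_equal; ring.
  - apply sph_cont_plus; apply cS.
  - apply sph_cont_plus; [apply cS|]; apply sph_cont_mult; [apply sph_cont_const | apply cS].
  - intros x hx.
    assert (v1 := hv x hx Ax1); assert (v2 := hv x hx Ax2); assert (v3 := hv x hx Ax3).
    assert (w1 := hw x hx Ax1); assert (w2 := hw x hx Ax2); assert (w3 := hw x hx Ax3).
    destruct (v x) as [[a1 a2] a3], (neg_lap3_pow r n w x) as [[b1 b2] b3].
    cbn [ccoord comp1 comp2 comp3 fst snd] in *; subst.
    cbn [dot3 conj3]; unfold cev, Cconj, Cmult, Cplus, sum3, D; cbn [fst snd]; f_equal; ring.
Qed.

(** * A Poincare inequality for singular functions *)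

Definition invdist (r : R) (z x : R3) : R := / sqrt (sqdist r z x).

Lemma invdist_pos (r : R) (z x : R3) :
  0 < r -> in_ball r z -> on_sphere r x -> 0 < invdist r z x.
Proof.
  intros hr hz hx; apply Rinv_0_lt_compat, sqrt_lt_R0, sqdist_pos; assumption.
Qed.

Lemma invdist_sqr (r : R) (z x : R3) :
  0 < r -> in_ball r z -> on_sphere r x -> invdist r z x ^ 2 * sqdist r z x = 1.
Proof.
  intros hr hz hx; unfold invdist.
  assert (h := sqdist_pos r z x hr hz hx).
  assert (0 < sqrt (sqdist r z x)) by (apply sqrt_lt_R0; exact h).
  rewrite <- (sqrt_sqrt (sqdist r z x)) at 2 by lra; field; lra.
Qed.

Lemma sph_cont_pow (r : R) (f : R3 -> R) (n : nat) :
  sph_cont r f -> sph_cont r (fun x => f x ^ n).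
Proof.
  intros hf; induction n as [|n IH]; [exact (sph_cont_const r 1)|].
  exact (sph_cont_mult r f (fun x => f x ^ n) hf IH).
Qed.

Lemma invdist_cont (r : R) (z : R3) (n : nat) :
  0 < r -> in_ball r z -> sph_cont r (fun x => invdist r z x ^ n).
Proof.
  intros hr hz; apply sph_cont_pow; exact (ev_cont r z z EInv hr hz).
Qed.

Lemma dotr_cont (r : R) (z : R3) : sph_cont r (fun x => dotr x z).
Proof.
  apply (sph_cont_sum3 r (fun i x => coord i x * coord i z)).
  intros i; apply sph_cont_mult; [apply sph_cont_coord | apply sph_cont_const].
Qed.

Lemma coord_le (i : axis) (x : R3) : Rabs (coord i x) <= norm3 x.
Proof.
  apply Rsqr_incr_0_var; [|apply norm3_pos].
  rewrite <- Rsqr_abs, !Rsqr_pow2, norm3_sqr.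
  destruct i; unfold dotr, sum3; nra.
Qed.

(** The only atom that can blow up is [EInv], at most 1 / d. The bound is chosen before z and p. It
    serves for the fixed pole y, with d = r - |y|, and for moving poles away from their singularity,
    with d = r / 2. *)
Lemma ev_bounded (r d : R) (e : sexpr) :
  0 < r -> 0 < d ->
  exists C, 0 <= C /\ forall z p x, on_sphere r x -> norm3 z <= r -> norm3 p <= 1 ->
    d ^ 2 <= sqdist r z x -> Rabs (ev r z p e x) <= C.
Proof.
  intros hr hd; induction e as [c|i|i|i| |e1 [C1 [h1 H1]] e2 [C2 [h2 H2]]
                                       |e1 [C1 [h1 H1]] e2 [C2 [h2 H2]]]; cbn [ev].
  - exists (Rabs c); split; [apply Rabs_pos | intros; lra].
  - exists r; split; [lra|]; intros z p x hx _ _ _.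
    rewrite <- (on_sphere_norm3 r x hr hx); apply coord_le.
  - exists r; split; [lra|]; intros z p x _ hz _ _.
    eapply Rle_trans; [apply coord_le | exact hz].
  - exists 1; split; [lra|]; intros z p x _ _ hp _.
    eapply Rle_trans; [apply coord_le | exact hp].
  - exists (/ d); split; [left; apply Rinv_0_lt_compat, hd|]; intros z p x _ _ _ hw.
    apply sqrt_le_1_alt in hw; rewrite sqrt_pow2 in hw by lra.
    rewrite Rabs_pos_eq by (left; apply Rinv_0_lt_compat; lra).
    apply Rinv_le_contravar; assumption.
  - exists (C1 + C2); split; [lra|]; intros z p x hx hz hp hw.
    eapply Rle_trans; [apply Rabs_triang|]; apply Rplus_le_compat; auto.
  - exists (C1 * C2); split; [apply Rmult_le_pos; assumption|]; intros z p x hx hz hp hw.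
    rewrite Rabs_mult; apply Rmult_le_compat; auto using Rabs_pos.
Qed.

Lemma ev_diff_XZ (r : R) (z p x : R3) (k : axis) :
  ev r z p (diff r k XZ) x = coord k z - coord k x * dotr x z / r ^ 2.
Proof.
  unfold XZ, sumE, Rdiv, dotr, sum3; destruct k; cbn [ev diff kron];
    generalize (/ r ^ 2); intros; ring.
Qed.

(** A linear function is a spherical harmonic of degree 1, with eigenvalue 2 / r^2. *)
Lemma ev_lap_XZ (r : R) (z p x : R3) :
  0 < r -> on_sphere r x -> ev r z p (lapE r XZ) x = 2 / r ^ 2 * dotr x z.
Proof.
  intros hr hx.
  assert (h : / r ^ 2 * dotr x x = 1) by (rewrite hx; field; lra).
  transitivity (/ r ^ 2 * dotr x z * (4 - 2 * (/ r ^ 2 * dotr x x))); [|rewrite h; field; lra].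
  clear h hx; unfold lapE, XZ, sumE, dotr, sum3; cbn [ev diff kron].
  generalize (/ r ^ 2); intros; ring.
Qed.

Lemma sum_sqr_diff_XZ (r : R) (z x : R3) :
  0 < r -> on_sphere r x ->
  sum3 (fun k => (coord k z - coord k x * dotr x z / r ^ 2) ^ 2)
  = (r ^ 2 * dotr z z - dotr x z ^ 2) / r ^ 2.
Proof.
  intros hr hx.
  remember (dotr x z) as s eqn:es.
  transitivity (dotr z z - 2 * s * dotr x z / r ^ 2 + dotr x x * s ^ 2 / r ^ 2 / r ^ 2).
  - unfold dotr, sum3; field; lra.
  - rewrite hx, <- es; field; lra.
Qed.

(* Stokes' theorem for the tangent field g^2 grad(x.z), whose divergence is
   negative near z/|z|: a Poincare inequality for functions that are bounded
   away from the singularity. *)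
Lemma poincare (r : R) (e : sexpr) :
  0 < r ->
  exists A B, 0 <= A /\ 0 <= B /\ forall z p, in_ball r z -> norm3 p <= 1 ->
    sint r (fun x => ev r z p e x ^ 2) <= A * sint r (fun x => ev r z p (lapE r e) x ^ 2) + B.
Proof.
  intros hr.
  destruct (ev_bounded r (r / 2) e hr) as [C [hC HC]]; [lra|].
  assert (hPI := PI_RGT_0).
  (* With G and H the integrals of g^2 and (L g)^2 and D that of |grad g|^2: [E1] gives G/2 <= 48
     r^2 D + 16 pi r^2 C^2, and [E2] gives 48 r^2 D <= G/4 + 2304 r^4 H. Absorbing G/4 and
     multiplying by 4 yields these constants. *)
  exists (9216 * r ^ 4), (64 * PI * r ^ 2 * C ^ 2).
  split; [|split].
  { apply Rmult_le_pos; [lra | apply pow_le; lra]. }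
  { assert (0 <= r ^ 2) by apply pow2_ge_0; assert (0 <= C ^ 2) by apply pow2_ge_0.
    apply Rmult_le_pos; [apply Rmult_le_pos|]; lra. }
  intros z p hz hp.
  set (g := ev r z p e).
  set (dg := fun k => ev r z p (diff r k e)).
  set (lg := ev r z p (lapE r e)).
  assert (cg : sph_cont r g) by (apply ev_cont; assumption).
  assert (cdg : forall k, sph_cont r (dg k)) by (intros; apply ev_cont; assumption).
  assert (clg : sph_cont r lg) by (apply ev_cont; assumption).
  assert (cg2 : sph_cont r (fun x => g x ^ 2))
    by (apply sph_cont_pow; assumption).
  assert (clg2 : sph_cont r (fun x => lg x ^ 2))
    by (apply sph_cont_pow; assumption).
  assert (cD : sph_cont r (fun x => sum3 (fun k => dg k x * dg k x))).
  { apply (sph_cont_sum3 r (fun k x => dg k x * dg k x)).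
    intros k; apply sph_cont_mult; auto. }
  assert (nz : norm3 z <= r) by (unfold in_ball in hz; lra).
  assert (E1 : sint r (fun x => 3 / 4 * g x ^ 2 + - (4 * C ^ 2))
            <= sint r (fun x => 1 / 4 * g x ^ 2 + 48 * r ^ 2 * sum3 (fun k => dg k x * dg k x))).
  { apply Rle_trans with (sint r (fun x => ev r z p (EMul e e) x * ev r z p (lapE r XZ) x)).
    - apply sint_le.
      + apply sph_cont_plus; [|apply sph_cont_const].
        apply sph_cont_mult; [apply sph_cont_const | exact cg2].
      + apply sph_cont_mult; apply ev_cont; assumption.
      + intros x hx; rewrite ev_lap_XZ by assumption; cbn [ev]; fold g.
        assert (hs := dotr_le x z); rewrite (on_sphere_norm3 r x hr hx) in hs.
        apply Rabs_le_between in hs.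
        assert (hz0 := norm3_pos z).
        assert (h2 : 2 / r ^ 2 * dotr x z = 2 * (dotr x z / r ^ 2)) by (field; lra).
        rewrite h2.
        assert (hr2 : 0 < r ^ 2) by (apply pow_lt; exact hr).
        destruct (Rle_or_lt ((r / 2) ^ 2) (sqdist r z x)) as [far|near].
        (* Nearer than r / 2 to z, x.z exceeds 3 r^2 / 8 and the weight is at least 3/4. Farther
           away it is at least -2, while g^2 <= C^2, so the constant 4 C^2 covers the loss. *)
        * assert (hb := HC z p x hx nz hp far); fold g in hb.
          assert (hg : g x ^ 2 <= C ^ 2).
          { rewrite <- (pow2_abs (g x)); apply pow_incr; split; [apply Rabs_pos | exact hb]. }
          assert (-1 <= dotr x z / r ^ 2).
          { apply Rle_div_r; [exact hr2|]; nra. }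
          nra.
        * assert (3 / 8 <= dotr x z / r ^ 2).
          { apply (Rle_div_r (3 / 8) (dotr x z) (r ^ 2) hr2); unfold sqdist in near.
            assert (hzz := dotr_self_pos z); lra. }
          nra.
    - rewrite sint_lapE by assumption.
      apply sint_le.
      + apply (sph_cont_sum3 r (fun k x => ev r z p (diff r k (EMul e e)) x * ev r z p (diff r k XZ) x)).
        intros k; apply sph_cont_mult; apply ev_cont; assumption.
      + apply sph_cont_plus; apply sph_cont_mult; auto using sph_cont_const.
      + intros x hx; cbn [diff ev]; fold g.
        assert (hS : forall k, ev r z p (diff r k XZ) x ^ 2 <= 4 * r ^ 2).
        { intros k; rewrite ev_diff_XZ.
          assert (hk := coord_le k z); assert (hk' := coord_le k x).
          rewrite (on_sphere_norm3 r x hr hx) in hk'.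
          assert (hs := dotr_le x z); rewrite (on_sphere_norm3 r x hr hx) in hs.
          assert (hq : Rabs (coord k x * dotr x z / r ^ 2) <= r).
          { assert (hr2 : 0 < r ^ 2) by (apply pow_lt; exact hr).
            unfold Rdiv; rewrite Rabs_mult, (Rabs_pos_eq (/ r ^ 2))
              by (left; apply Rinv_0_lt_compat; exact hr2).
            apply Rle_div_l; [exact hr2|]; rewrite Rabs_mult.
            replace (r * r ^ 2) with (r * (r * r)) by ring.
            apply Rmult_le_compat; auto using Rabs_pos; nra. }
          rewrite <- pow2_abs; replace (4 * r ^ 2) with ((2 * r) ^ 2) by ring.
          apply pow_incr; split; [apply Rabs_pos|].
          unfold Rminus; eapply Rle_trans; [apply Rabs_triang|].
          rewrite Rabs_Ropp; lra. }
        (* 2ab <= a^2 / 12 + 12 b^2 with a = g and b = S times the derivative of g, where S^2 <= 4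
           r^2; the three axes together cost g^2 / 4. *)
        assert (amgm : forall k, (g x * dg k x + dg k x * g x) * ev r z p (diff r k XZ) x
                  <= / 12 * g x ^ 2 + 48 * r ^ 2 * (dg k x * dg k x)).
        { intros k; specialize (hS k); revert hS; generalize (ev r z p (diff r k XZ) x); intros S hS.
          assert (12 * (dg k x * dg k x) * S ^ 2 <= 12 * (dg k x * dg k x) * (4 * r ^ 2))
            by (apply Rmult_le_compat_l; [nra | exact hS]).
          assert (0 <= (/ 12 * g x - dg k x * S) ^ 2) by apply pow2_ge_0.
          nra. }
        assert (a1 := amgm Ax1); assert (a2 := amgm Ax2); assert (a3 := amgm Ax3).
        unfold dg, sum3 in *; lra. }
  (* The weight 1 / (192 r^2) is chosen so that multiplication by 48 r^2 leaves exactly G/4. *)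
  assert (E2 : sint r (fun x => sum3 (fun k => dg k x * dg k x))
            <= sint r (fun x => / (192 * r ^ 2) * g x ^ 2 + 48 * r ^ 2 * lg x ^ 2)).
  { unfold dg; rewrite <- sint_lapE by assumption; fold g lg.
    apply sint_le.
    - apply sph_cont_mult; assumption.
    - apply sph_cont_plus; apply sph_cont_mult; auto using sph_cont_const.
    - intros x _.
      assert (0 <= / (192 * r ^ 2) * (g x - 96 * r ^ 2 * lg x) ^ 2).
      { apply Rmult_le_pos; [left; apply Rinv_0_lt_compat; nra | apply pow2_ge_0]. }
      replace (/ (192 * r ^ 2) * (g x - 96 * r ^ 2 * lg x) ^ 2)
        with (/ (192 * r ^ 2) * g x ^ 2 + 48 * r ^ 2 * lg x ^ 2 - g x * lg x) in H
        by (field; lra).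
      lra. }
  rewrite !sint_plus, !sint_scal in E1
    by (first [assumption | apply sph_cont_const
              | apply sph_cont_mult; first [assumption | apply sph_cont_const]]).
  rewrite !sint_plus, !sint_scal in E2
    by (first [assumption | apply sph_cont_const
              | apply sph_cont_mult; first [assumption | apply sph_cont_const]]).
  rewrite sint_const in E1.
  set (G := sint r (fun x => g x ^ 2)) in *.
  set (D := sint r (fun x => sum3 _)) in *.
  set (H := sint r (fun x => lg x ^ 2)) in *.
  assert (E3 : 48 * r ^ 2 * D <= 48 * r ^ 2 * (/ (192 * r ^ 2) * G + 48 * r ^ 2 * H))
    by (apply Rmult_le_compat_l; [nra | exact E2]).
  replace (48 * r ^ 2 * (/ (192 * r ^ 2) * G + 48 * r ^ 2 * H))
    with (/ 4 * G + 2304 * r ^ 4 * H) in E3 by (field; lra).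
  lra.
Qed.

Lemma poincare_iter (r : R) (e : sexpr) (n : nat) :
  0 < r ->
  exists A B, 0 <= A /\ 0 <= B /\ forall z p, in_ball r z -> norm3 p <= 1 ->
    sint r (fun x => ev r z p e x ^ 2)
    <= A * sint r (fun x => ev r z p (Nat.iter n (lapE r) e) x ^ 2) + B.
Proof.
  intros hr; induction n as [|n [A [B [hA [hB IH]]]]].
  - exists 1, 0; repeat split; try lra; intros; simpl Nat.iter; lra.
  - destruct (poincare r (Nat.iter n (lapE r) e) hr) as [A' [B' [hA' [hB' H]]]].
    exists (A * A'), (A * B' + B).
    assert (0 <= A * A') by (apply Rmult_le_pos; assumption).
    assert (0 <= A * B') by (apply Rmult_le_pos; assumption).
    repeat split; try lra; intros z p hz hp.
    specialize (IH z p hz hp); specialize (H z p hz hp); simpl Nat.iter.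
    apply (Rmult_le_compat_l A _ _ hA) in H; lra.
Qed.

(** * Moments of the inverse distance *)

Fixpoint powE (n : nat) : sexpr :=
  match n with O => ECst 1 | S m => EMul EInv (powE m) end.

Lemma ev_powE (r : R) (z p x : R3) (n : nat) : ev r z p (powE n) x = invdist r z x ^ n.
Proof. induction n as [|n IH]; [reflexivity|]; cbn [powE ev]; rewrite IH; reflexivity. Qed.

(** Powers of u are functions of the height x.z alone, so their gradients are multiples of its
    gradient. *)
Lemma ev_diff_powE (r : R) (z p x : R3) (n : nat) (k : axis) :
  ev r z p (diff r k (powE n)) x = INR n * invdist r z x ^ (n + 2) * ev r z p (diff r k XZ) x.
Proof.
  induction n as [|n IH].
  - simpl; ring.
  - rewrite S_INR; cbn [powE diff ev]; rewrite IH, ev_powE, ev_diff_XZ.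
    unfold XZ, sumE; cbn [ev]; fold (invdist r z x).
    replace (S n + 2)%nat with (S (n + 2)) by reflexivity.
    cbn [pow]; rewrite !pow_add; unfold Rdiv, dotr, sum3; ring.
Qed.

(** Integration by parts of u^n against x.z, multiplied by r^2. This relation between moments is
    used for n = 1, 2 and 4. *)
Lemma sint_zonal (r : R) (z : R3) (n : nat) :
  0 < r -> in_ball r z ->
  sint r (fun x => 2 * dotr x z * invdist r z x ^ n
    + - (INR n) * ((r ^ 2 * dotr z z - dotr x z ^ 2) * invdist r z x ^ (n + 2))) = 0.
Proof.
  intros hr hz.
  assert (cs := dotr_cont r z).
  assert (cU := fun m => invdist_cont r z m hr hz).
  assert (cS : sph_cont r (fun x => sum3 (fun k =>
    ev r z z (diff r k (powE n)) x * ev r z z (diff r k XZ) x))).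
  { apply (sph_cont_sum3 r (fun k x => ev r z z (diff r k (powE n)) x * ev r z z (diff r k XZ) x)).
    intros k; apply sph_cont_mult; apply ev_cont; assumption. }
  assert (E := sint_lapE r z z z z (powE n) XZ hr hz hz).
  assert (cL : sph_cont r (fun x => ev r z z (powE n) x * ev r z z (lapE r XZ) x))
    by (apply sph_cont_mult; apply ev_cont; assumption).
  transitivity (r ^ 2 * (sint r (fun x => ev r z z (powE n) x * ev r z z (lapE r XZ) x)
    + -1 * sint r (fun x => sum3 (fun k =>
        ev r z z (diff r k (powE n)) x * ev r z z (diff r k XZ) x)))); [|rewrite E; ring].
  rewrite <- (sint_scal r (-1)) by exact cS.
  rewrite <- sint_plus
    by (first [exact cL | apply sph_cont_mult; [apply sph_cont_const | exact cS]]).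
  rewrite <- sint_scal
    by (apply sph_cont_plus; [exact cL | apply sph_cont_mult; [apply sph_cont_const | exact cS]]).
  apply sint_ext; intros x hx.
  rewrite ev_lap_XZ, ev_powE by assumption.
  assert (hS := sum_sqr_diff_XZ r z x hr hx).
  transitivity (r ^ 2 * (invdist r z x ^ n * (2 / r ^ 2 * dotr x z)
    + -1 * (INR n * invdist r z x ^ (n + 2)
            * sum3 (fun k => (coord k z - coord k x * dotr x z / r ^ 2) ^ 2)))).
  - rewrite hS; field; lra.
  - unfold sum3; rewrite !ev_diff_powE, !ev_diff_XZ; ring.
Qed.

(** For n = 2, eliminating x.z makes the u^2 terms cancel: the integrand is b^2 u^4 / 2 - 1/2 with b
    = r^2 - |z|^2. *)
Lemma sint_invdist4 (r : R) (z : R3) :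
  0 < r -> in_ball r z ->
  sint r (fun x => invdist r z x ^ 4) = 4 * PI * r ^ 2 * (/ (r ^ 2 - dotr z z)) ^ 2.
Proof.
  intros hr hz.
  assert (cU := invdist_cont r z 4 hr hz).
  assert (hn : 0 < r ^ 2 - dotr z z).
  { rewrite <- norm3_sqr; assert (h := norm3_pos z); unfold in_ball in hz; nra. }
  set (b := r ^ 2 - dotr z z) in *.
  assert (E := sint_zonal r z 2 hr hz).
  rewrite (sint_ext r _ (fun x => b ^ 2 / 2 * invdist r z x ^ 4 + - (1 / 2))) in E.
  - rewrite sint_plus, sint_scal, sint_const in E;
      try (first [exact cU | apply sph_cont_const
             | apply sph_cont_mult; [apply sph_cont_const | exact cU]]).
    set (I := sint r _) in *.
    replace I with ((b ^ 2 / 2 * I) * (2 * (/ b) ^ 2)) by (field; lra).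
    replace (b ^ 2 / 2 * I) with (4 * PI * r ^ 2 * (1 / 2)) by lra.
    field; lra.
  - intros x hx; assert (h := invdist_sqr r z x hr hz hx); revert h.
    unfold sqdist, b; generalize (invdist r z x) (dotr x z) (dotr z z); intros U s a h.
    simpl INR; simpl Nat.add.
    assert (h' : 2 * s * U ^ 2 = (r ^ 2 + a) * U ^ 2 - 1) by lra.
    replace ((r ^ 2 * a - s ^ 2) * U ^ 4) with (r ^ 2 * a * U ^ 4 - (2 * s * U ^ 2) ^ 2 / 4) by field.
    rewrite h'; field.
Qed.

(** For n = 1 the integrand becomes (r^2 + |z|^2) u / 2 - 3 / (4 u) + (r^2 - |z|^2)^2 u^3 / 4.
    Dropping the nonnegative terms in |z|^2 u and u^3 and using 1/u <= 2 r leaves r^2 u / 2 - 3 r /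
    2. The true value is 4 pi r, from the potential of a uniform shell. *)
Lemma sint_invdist1 (r : R) (z : R3) :
  0 < r -> in_ball r z -> sint r (fun x => invdist r z x ^ 1) <= 12 * PI * r.
Proof.
  intros hr hz.
  assert (cU := fun n => invdist_cont r z n hr hz).
  assert (cs := dotr_cont r z).
  assert (E := sint_zonal r z 1 hr hz).
  assert (hle : sint r (fun x => r ^ 2 / 2 * invdist r z x ^ 1 + - (3 / 2 * r)) <= 0).
  { rewrite <- E; apply sint_le.
    - apply sph_cont_plus; [|apply sph_cont_const].
      apply sph_cont_mult; [apply sph_cont_const | apply cU].
    - apply sph_cont_plus; apply sph_cont_mult; auto using sph_cont_const, sph_cont_mult.
      apply sph_cont_mult; [|apply (cU 3%nat)].
      apply (sph_cont_ext r (fun x => r ^ 2 * dotr z z + -1 * dotr x z ^ 2)); [intros; ring|].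
      apply sph_cont_plus; [apply sph_cont_const|].
      apply sph_cont_mult; [apply sph_cont_const | apply sph_cont_pow, cs].
    - intros x hx; assert (h := invdist_sqr r z x hr hz hx).
      assert (hU := invdist_pos r z x hr hz hx).
      assert (hw : sqdist r z x * invdist r z x <= 2 * r).
      { assert (e1 : (sqdist r z x * invdist r z x) ^ 2 <= (2 * r) ^ 2).
        { replace ((sqdist r z x * invdist r z x) ^ 2)
            with (invdist r z x ^ 2 * sqdist r z x * sqdist r z x) by ring.
          rewrite h; unfold sqdist.
          assert (hs := dotr_le x z); rewrite (on_sphere_norm3 r x hr hx) in hs.
          apply Rabs_le_between in hs.
          rewrite <- (norm3_sqr z); assert (hz0 := norm3_pos z); unfold in_ball in hz; nra. }
        apply Rsqr_incr_0_var; [rewrite !Rsqr_pow2; exact e1 | lra]. }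
      assert (hz0 := dotr_self_pos z).
      revert h hU hw; unfold sqdist; generalize (invdist r z x).
      revert hz0; generalize (dotr x z) (dotr z z); intros s a ha U h hU hw.
      simpl INR; simpl Nat.add.
      assert (h' : 2 * s * U ^ 2 = (r ^ 2 + a) * U ^ 2 - 1) by lra.
      assert (h3 : U ^ 3 * (r ^ 2 - a) ^ 2 >= 0).
      { apply Rle_ge, Rmult_le_pos; [apply pow_le; lra | apply pow2_ge_0]. }
      assert (h4 : s ^ 2 * U ^ 3 = ((r ^ 2 + a) ^ 2 * U ^ 3 - (r ^ 2 + a) * U - 2 * s * U) / 4).
      { replace (s ^ 2 * U ^ 3) with ((2 * s * U ^ 2) * (2 * s) * U / 4) by field.
        rewrite h'; replace (((r ^ 2 + a) * U ^ 2 - 1) * (2 * s) * U / 4)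
          with (((r ^ 2 + a) * U * (2 * s * U ^ 2) - 2 * s * U) / 4) by field.
        rewrite h'; field. }
      replace ((r ^ 2 * a - s ^ 2) * U ^ 3) with (r ^ 2 * a * U ^ 3 - s ^ 2 * U ^ 3) by ring.
      rewrite h4; nra. }
  rewrite sint_plus, sint_scal, sint_const in hle;
    try (first [apply cU | apply sph_cont_const
           | apply sph_cont_mult; [apply sph_cont_const | apply cU]]).
  set (I := sint r _) in *.
  apply Rmult_le_reg_l with (r ^ 2 / 2); [nra|]; lra.
Qed.

(** Pointwise, u^2 <= t^2 u^4 if t u >= 1 and u^2 <= u / t otherwise. The threshold t is left free,
    to be adapted to z. *)
Lemma sint_invdist2 (r : R) (z : R3) (t : R) :
  0 < r -> in_ball r z -> 0 < t ->
  sint r (fun x => invdist r z x ^ 2)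
  <= t ^ 2 * (4 * PI * r ^ 2 * (/ (r ^ 2 - dotr z z)) ^ 2) + 12 * PI * r / t.
Proof.
  intros hr hz ht.
  assert (cU := fun n => invdist_cont r z n hr hz).
  rewrite <- sint_invdist4 by assumption.
  apply Rle_trans with (sint r (fun x => t ^ 2 * invdist r z x ^ 4 + / t * invdist r z x ^ 1)).
  - apply sint_le.
    + apply cU.
    + apply sph_cont_plus; apply sph_cont_mult; auto using sph_cont_const.
    + intros x hx; assert (hU := invdist_pos r z x hr hz hx); revert hU.
      generalize (invdist r z x); intros U hU.
      assert (hti : 0 < / t) by (apply Rinv_0_lt_compat; exact ht).
      destruct (Rle_or_lt 1 (t * U)) as [h|h].
      * assert (1 <= (t * U) ^ 2) by nra.
        assert (U ^ 2 * 1 <= U ^ 2 * (t * U) ^ 2) by (apply Rmult_le_compat_l; [nra | assumption]).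
        assert (0 <= / t * U ^ 1) by nra.
        nra.
      * assert (U <= / t).
        { apply Rmult_le_reg_l with t; [exact ht|]; rewrite Rinv_r by lra; lra. }
        assert (0 <= t ^ 2 * U ^ 4) by (apply Rmult_le_pos; apply pow_le; lra).
        nra.
  - rewrite sint_plus, !sint_scal by auto using sph_cont_mult, sph_cont_const.
    apply Rplus_le_compat_l.
    assert (h := sint_invdist1 r z hr hz).
    unfold Rdiv; rewrite Rmult_comm; apply Rmult_le_compat_r; [|exact h].
    left; apply Rinv_0_lt_compat; exact ht.
Qed.

(** * Identities from the rotations about z *)

Definition rotE (k : axis) : sexpr :=
  match k with
  | Ax1 => EAdd (EMul (EZ Ax2) (EX Ax3)) (EMul (ECst (-1)) (EMul (EZ Ax3) (EX Ax2)))
  | Ax2 => EAdd (EMul (EZ Ax3) (EX Ax1)) (EMul (ECst (-1)) (EMul (EZ Ax1) (EX Ax3)))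
  | Ax3 => EAdd (EMul (EZ Ax1) (EX Ax2)) (EMul (ECst (-1)) (EMul (EZ Ax2) (EX Ax1)))
  end.

(* The field x |-> z * x (cross product) generates the rotations about z. *)
Lemma sint_rot (r : R) (z p : R3) (e : sexpr) :
  0 < r -> in_ball r z ->
  sint r (fun x => sum3 (fun k => ev r z p (rotE k) x * ev r z p (diff r k e) x)) = 0.
Proof.
  intros hr hz.
  rewrite <- (sint_divergence r (fun k => ev r z p (EMul (rotE k) e))
    (fun k j => ev r z p (diff r j (EMul (rotE k) e))) hr
    (fun k => ev_tangential r z p (EMul (rotE k) e) hr hz)).
  - apply sint_ext; intros x _; unfold sum3, rotE; cbn [ev diff kron]; ring.
  - intros x _; unfold sum3, rotE; cbn [ev]; ring.
Qed.

Definition sumPE (F : axis -> sexpr) : sexpr := sumE (fun i => EMul (F i) (EP i)).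

Definition zzE : sexpr := sumE (fun i => EMul (EZ i) (EZ i)).

Definition cubeE (e : sexpr) : sexpr := EMul e (EMul e e).
Definition invdist6E : sexpr := EMul (cubeE EInv) (cubeE EInv).

(* With x' the part of x orthogonal to z: tripleE = det(z, x, p) and
   perpE = |z|^2 (x' . p); the rotation about z maps tripleE to - perpE. *)
Definition tripleE : sexpr := sumPE rotE.
Definition perpE : sexpr :=
  EAdd (EMul zzE (sumPE EX)) (EMul (ECst (-1)) (EMul XZ (sumPE EZ))).

Lemma ev_perpE (r : R) (z p x : R3) :
  ev r z p perpE x = dotr z z * dotr x p - dotr x z * dotr z p.
Proof. unfold perpE, sumPE, zzE, XZ, sumE, dotr, sum3; cbn [ev]; ring. Qed.

(** The rotation derivative of u^6 [tripleE] [perpE]: u is invariant, [tripleE] goes to - [perpE],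
    and [perpE] to |z|^2 [tripleE]. In the mean, the two transverse directions therefore weigh the
    same. *)
Lemma sint_rot_quadratic (r : R) (z p : R3) :
  0 < r -> in_ball r z ->
  sint r (fun x => invdist r z x ^ 6
    * (dotr z z * ev r z p tripleE x ^ 2 - ev r z p perpE x ^ 2)) = 0.
Proof.
  intros hr hz.
  rewrite <- (sint_rot r z p (EMul invdist6E (EMul tripleE perpE)) hr hz).
  apply sint_ext; intros x _.
  unfold invdist6E, cubeE, perpE, tripleE, sumPE, zzE, rotE, XZ, sumE, dotr, sum3;
    cbn [ev diff kron]; fold (invdist r z x); generalize (invdist r z x) (/ r ^ 2); intros; ring.
Qed.

(** The factor |z|^2 - x.z is also invariant; the identity removes the cross term between the axial
    and the transverse part of p. *)
Lemma sint_rot_linear (r : R) (z p : R3) :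
  0 < r -> in_ball r z ->
  sint r (fun x => invdist r z x ^ 6 * ((dotr x z - dotr z z) * ev r z p perpE x)) = 0.
Proof.
  intros hr hz.
  assert (E := sint_rot r z p (EMul invdist6E (EMul (EAdd (EMul (ECst (-1)) XZ) zzE) tripleE)) hr hz).
  rewrite <- E.
  apply sint_ext; intros x _.
  unfold invdist6E, cubeE, perpE, tripleE, sumPE, zzE, rotE, XZ, sumE, dotr, sum3;
    cbn [ev diff kron]; fold (invdist r z x); generalize (invdist r z x) (/ r ^ 2); intros; ring.
Qed.

(** * Lower bound for the dipole field and the limit *)

(** The zonal identity for n = 4, with 2 x.z u^4 = (r^2 + |z|^2) u^4 - u^2 and u^2 <= r^2 u^4 / 2 +
    1 / (2 r^2). The right-hand weight is |z|^2 times the squared distance of x from the axis of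
    z. *)
Lemma sint_zonal4_ge (r : R) (z : R3) :
  0 < r -> in_ball r z ->
  r ^ 2 / 4 * sint r (fun x => invdist r z x ^ 4) - PI
  <= 2 * sint r (fun x => (r ^ 2 * dotr z z - dotr x z ^ 2) * invdist r z x ^ 6).
Proof.
  intros hr hz.
  assert (cU := fun n => invdist_cont r z n hr hz).
  assert (cs := dotr_cont r z).
  assert (cW : sph_cont r (fun x => (r ^ 2 * dotr z z - dotr x z ^ 2) * invdist r z x ^ 6)).
  { apply sph_cont_mult; [|apply cU].
    apply (sph_cont_ext r (fun x => r ^ 2 * dotr z z + -1 * dotr x z ^ 2)); [intros; ring|].
    apply sph_cont_plus; [apply sph_cont_const|].
    apply sph_cont_mult; [apply sph_cont_const | apply sph_cont_pow, cs]. }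
  assert (cT : sph_cont r (fun x => 2 * dotr x z * invdist r z x ^ 4)).
  { apply sph_cont_mult; [|apply cU]; apply sph_cont_mult; [apply sph_cont_const | exact cs]. }
  assert (E := sint_zonal r z 4 hr hz).
  rewrite sint_plus, (sint_scal r (- INR 4)) in E
    by (first [exact cT | exact cW | apply sph_cont_mult; [apply sph_cont_const | exact cW]]).
  replace (INR 4) with 4 in E by (simpl; ring).
  simpl Nat.add in E.
  assert (hle : sint r (fun x => r ^ 2 / 2 * invdist r z x ^ 4 + - (/ (2 * r ^ 2)))
                <= sint r (fun x => 2 * dotr x z * invdist r z x ^ 4)).
  { apply sint_le; [|exact cT|].
    - apply sph_cont_plus; [|apply sph_cont_const].
      apply sph_cont_mult; [apply sph_cont_const | apply cU].
    - intros x hx; assert (h := invdist_sqr r z x hr hz hx).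
      assert (hz0 := dotr_self_pos z); revert h hz0; unfold sqdist.
      generalize (invdist r z x) (dotr x z) (dotr z z); intros U s a h ha.
      replace (2 * s * U ^ 4) with ((2 * s * U ^ 2) * U ^ 2) by ring.
      replace (2 * s * U ^ 2) with ((r ^ 2 + a) * U ^ 2 - 1) by lra.
      assert (hr2 : 0 < r ^ 2) by (apply pow_lt; exact hr).
      assert (hq : 0 <= r ^ 2 / 2 * (U ^ 2 - / r ^ 2) ^ 2)
        by (apply Rmult_le_pos; [lra | apply pow2_ge_0]).
      replace (r ^ 2 / 2 * (U ^ 2 - / r ^ 2) ^ 2)
        with (r ^ 2 / 2 * U ^ 4 - U ^ 2 + / (2 * r ^ 2)) in hq by (field; lra).
      assert (0 <= a * (U ^ 2) ^ 2) by (apply Rmult_le_pos; [exact ha | apply pow2_ge_0]).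
      lra. }
  rewrite sint_plus, sint_scal, sint_const in hle
    by (first [apply cU | apply sph_cont_const
          | apply sph_cont_mult; [apply sph_cont_const | apply cU]]).
  replace (4 * PI * r ^ 2 * - / (2 * r ^ 2)) with (- (2 * PI)) in hle by (field; lra).
  lra.
Qed.

(** Lagrange's identity for the cross product of x - z and p. *)
Lemma dipE_sum_sqr (r : R) (z p x : R3) :
  on_sphere r x ->
  sum3 (fun i => ev r z p (dipE i) x ^ 2)
  = / (16 * PI ^ 2) * (invdist r z x ^ 6
      * (sqdist r z x * dotr p p - (dotr x p - dotr z p) ^ 2)).
Proof.
  intros hx.
  unfold dipE; cbn [ev]; fold (invdist r z x).
  generalize (invdist r z x); intros U; unfold sqdist; rewrite <- hx.
  unfold sum3, crossE, XmZ, dotr, sum3; cbn [ev].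
  replace (/ (16 * PI ^ 2)) with (/ (4 * PI) * / (4 * PI))
    by (field; apply PI_neq0).
  ring.
Qed.

(** The cross product is at most |x-z| |p|, which takes one power off u^3; the prefactor 1 / (4 pi)
    is at most 1. *)
Lemma dipE_le (r : R) (z p x : R3) (i : axis) :
  0 < r -> in_ball r z -> on_sphere r x -> dotr p p <= 1 ->
  Rabs (ev r z p (dipE i) x) <= invdist r z x ^ 2.
Proof.
  intros hr hz hx hp.
  assert (e := dipE_sum_sqr r z p x hx).
  assert (h := invdist_sqr r z x hr hz hx).
  assert (hd := sqdist_pos r z x hr hz hx).
  assert (hU := invdist_pos r z x hr hz hx).
  apply Rsqr_incr_0_var; [|apply pow_le; lra].
  rewrite <- Rsqr_abs, !Rsqr_pow2.
  apply Rle_trans with (sum3 (fun i => ev r z p (dipE i) x ^ 2)).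
  - assert (q := fun j => pow2_ge_0 (ev r z p (dipE j) x)).
    assert (q1 := q Ax1); assert (q2 := q Ax2); assert (q3 := q Ax3).
    unfold sum3; destruct i; lra.
  - rewrite e; set (U := invdist r z x) in *.
    replace ((U ^ 2) ^ 2) with (1 * (U ^ 6 * sqdist r z x))
      by (replace (U ^ 6 * sqdist r z x) with (U ^ 4 * (U ^ 2 * sqdist r z x)) by ring;
          rewrite h; ring).
    assert (hPI : 1 <= 16 * PI ^ 2).
    { assert (hp2 := PI2_1); assert (1 < PI) by lra; nra. }
    assert (hU6 : 0 <= U ^ 6) by (apply pow_le; lra).
    assert (hc := dotr_cauchy (sub3 x z) p).
    rewrite <- (sqdist_sub3 r z x hx) in hc.
    replace (dotr (sub3 x z) p) with (dotr x p - dotr z p) in hc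
      by (destruct x as [[? ?] ?], z as [[? ?] ?]; unfold dotr, sum3; simpl; ring).
    apply Rmult_le_compat.
    + left; apply Rinv_0_lt_compat; lra.
    + apply Rmult_le_pos; [exact hU6 | lra].
    + rewrite <- Rinv_1; apply Rinv_le_contravar; lra.
    + apply Rmult_le_compat_l; [exact hU6|].
      assert (sqdist r z x * dotr p p <= sqdist r z x * 1)
        by (apply Rmult_le_compat_l; lra).
      assert (0 <= (dotr x p - dotr z p) ^ 2) by apply pow2_ge_0.
      lra.
Qed.

(** In the plane orthogonal to z, the squared determinant and the squared scalar product of the
    projections of x and p add up to the product of their squared lengths; both sides carry a factor
    |z|^4. *)
Lemma gram_identity (r : R) (z p x : R3) :
  on_sphere r x ->
  dotr z z * ev r z p tripleE x ^ 2 + ev r z p perpE x ^ 2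
  = (r ^ 2 * dotr z z - dotr x z ^ 2) * (dotr z z * dotr p p - dotr z p ^ 2).
Proof.
  intros hx; rewrite <- hx, ev_perpE.
  unfold tripleE, sumPE, sumE, rotE, dotr, sum3; cbn [ev]; ring.
Qed.

(** Split x - z and p along z: |z|^2 (x-z).p = [perpE] + (x.z - |z|^2) (z.p). The linear rotation
    identity removes the cross term, and the quadratic one together with [gram_identity] replaces
    [perpE]^2 by half of the Gram product, so half of the transverse weight survives whatever the
    direction of p. *)
Lemma dipE_norm_ge (r : R) (z p : R3) :
  0 < r -> in_ball r z -> 0 < dotr z z ->
  dotr p p * (/ (64 * PI ^ 2 * r ^ 2)
    * (r ^ 2 / 4 * sint r (fun x => invdist r z x ^ 4) - PI))
  <= sum3 (fun i => sint r (fun x => ev r z p (dipE i) x ^ 2)).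
Proof.
  intros hr hz ha.
  assert (cU := fun n => invdist_cont r z n hr hz).
  assert (cs := dotr_cont r z).
  assert (ce := fun e => ev_cont r z p e hr hz).
  set (W := fun x => (r ^ 2 * dotr z z - dotr x z ^ 2) * invdist r z x ^ 6).
  set (Q := fun x => invdist r z x ^ 6
               * (dotr z z * ev r z p tripleE x ^ 2 - ev r z p perpE x ^ 2)).
  set (L := fun x => invdist r z x ^ 6 * ((dotr x z - dotr z z) * ev r z p perpE x)).
  assert (cW : sph_cont r W).
  { apply sph_cont_mult; [|apply cU].
    apply (sph_cont_ext r (fun x => r ^ 2 * dotr z z + -1 * dotr x z ^ 2)); [intros; ring|].
    apply sph_cont_plus; [apply sph_cont_const|].
    apply sph_cont_mult; [apply sph_cont_const | apply sph_cont_pow, cs]. }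
  assert (cQ : sph_cont r Q).
  { apply sph_cont_mult; [apply cU|].
    apply (sph_cont_ext r (fun x => dotr z z * ev r z p tripleE x ^ 2 + -1 * ev r z p perpE x ^ 2));
      [intros; ring|].
    apply sph_cont_plus; apply sph_cont_mult; auto using sph_cont_const, sph_cont_pow. }
  assert (cL : sph_cont r L).
  { apply sph_cont_mult; [apply cU|]; apply sph_cont_mult; [|apply ce].
    apply sph_cont_plus; [exact cs | apply sph_cont_const]. }
  assert (cD : forall i, sph_cont r (fun x => ev r z p (dipE i) x ^ 2))
    by (intros; apply sph_cont_pow, ce).
  set (N := sum3 (fun i => sint r (fun x => ev r z p (dipE i) x ^ 2))).
  set (K := / (16 * PI ^ 2)).
  set (P := dotr p p).
  assert (hPI := PI_RGT_0).
  assert (hK : 0 < K) by (apply Rinv_0_lt_compat; assert (0 < PI ^ 2) by (apply pow_lt; lra); lra).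
  assert (hP : 0 <= P) by apply dotr_self_pos.
  set (a := dotr z z) in *.
  assert (main : K * (/ 2 * (a * P) * sint r W) <= a ^ 2 * N).
  { assert (eQ : sint r Q = 0) by (apply sint_rot_quadratic; assumption).
    assert (eL : sint r L = 0) by (apply sint_rot_linear; assumption).
    assert (eN : N = sint r (fun x => sum3 (fun i => ev r z p (dipE i) x ^ 2)))
      by (symmetry; apply (sint_sum3 r (fun i x => ev r z p (dipE i) x ^ 2)); exact cD).
    (* Two vanishing integrals are added, after which the inequality holds pointwise. The factor a^2
       on the other side clears the denominators of the splitting along z. *)
    replace (K * (/ 2 * (a * P) * sint r W))
      with (K * (/ 2 * (a * P)) * sint r W
            + (K / 2 * sint r Q + - (2 * K * dotr z p) * sint r L))
      by (rewrite eQ, eL; ring).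
    rewrite eN.
    rewrite <- (sint_scal r (a ^ 2))
      by (apply (sph_cont_sum3 r (fun i x => ev r z p (dipE i) x ^ 2)); exact cD).
    rewrite <- !sint_scal by assumption.
    rewrite <- !sint_plus
      by (repeat first [assumption | apply sph_cont_plus | apply sph_cont_mult
             | apply sph_cont_const]).
    apply sint_le.
    - repeat first [assumption | apply sph_cont_plus | apply sph_cont_mult
             | apply sph_cont_const].
    - apply sph_cont_mult; [apply sph_cont_const|].
      apply (sph_cont_sum3 r (fun i x => ev r z p (dipE i) x ^ 2)); exact cD.
    - intros x hx; rewrite dipE_sum_sqr by exact hx; fold K P; unfold W, Q, L.
      assert (hG := gram_identity r z p x hx); fold a P in hG.
      assert (hB := ev_perpE r z p x); fold a in hB.
      assert (hU := invdist_pos r z x hr hz hx).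
      assert (hU6 : 0 <= K * invdist r z x ^ 6)
        by (apply Rmult_le_pos; [lra | apply pow_le; lra]).
      assert (hW : 0 <= r ^ 2 * a - dotr x z ^ 2).
      { assert (h := dotr_cauchy x z); rewrite hx in h; fold a in h; lra. }
      assert (hzp : dotr z p ^ 2 <= a * P) by apply dotr_cauchy.
      unfold sqdist; fold a.
      revert hG hB hU6 hW hzp.
      generalize (invdist r z x ^ 6) (ev r z p tripleE x) (ev r z p perpE x)
        (dotr x z) (dotr x p) (dotr z p).
      intros U6 A B s xp zp hG hB hU6 hW hzp.
      (* What remains is a sum of two terms, each nonnegative by Cauchy-Schwarz. *)
      match goal with |- ?lhs <= ?rhs => apply Rminus_le; replace (lhs - rhs) with
        (- (K * U6 * ((s - a) ^ 2 * (a * P - zp ^ 2) + / 2 * ((r ^ 2 * a - s ^ 2) * zp ^ 2)))) end.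
      + assert (0 <= (s - a) ^ 2 * (a * P - zp ^ 2))
          by (apply Rmult_le_pos; [apply pow2_ge_0 | lra]).
        assert (0 <= (r ^ 2 * a - s ^ 2) * zp ^ 2)
          by (apply Rmult_le_pos; [lra | apply pow2_ge_0]).
        assert (0 <= K * U6 * ((s - a) ^ 2 * (a * P - zp ^ 2) + / 2 * ((r ^ 2 * a - s ^ 2) * zp ^ 2)))
          by (apply Rmult_le_pos; lra).
        lra.
      + replace (K / 2 * (U6 * (a * A ^ 2 - B ^ 2)))
          with (K / 2 * (U6 * ((a * A ^ 2 + B ^ 2) - 2 * B ^ 2))) by ring.
        rewrite hG, hB; field. }
  set (X := r ^ 2 / 4 * sint r (fun x => invdist r z x ^ 4) - PI).
  assert (hX : X <= 2 * sint r W) by (apply sint_zonal4_ge; assumption).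
  assert (hN : 0 <= N).
  { unfold N, sum3.
    assert (q : forall i, 0 <= sint r (fun x => ev r z p (dipE i) x ^ 2)).
    { intros i; replace 0 with (sint r (fun _ => 0)) by (rewrite sint_const; ring).
      apply sint_le; [apply sph_cont_const | apply cD | intros; apply pow2_ge_0]. }
    assert (q1 := q Ax1); assert (q2 := q Ax2); assert (q3 := q Ax3); lra. }
  assert (har : a <= r ^ 2).
  { unfold a; rewrite <- norm3_sqr; assert (h := norm3_pos z); unfold in_ball in hz; nra. }
  replace (/ (64 * PI ^ 2 * r ^ 2)) with (K / 4 * / r ^ 2) by (unfold K; field; lra).
  assert (hr2 : 0 < r ^ 2) by (apply pow_lt; exact hr).
  assert (main' : K / 4 * P * X <= a * N).
  { apply Rmult_le_reg_l with a; [exact ha|].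
    assert (0 <= K * (a * P)) by (repeat apply Rmult_le_pos; lra).
    assert (K * (a * P) * X <= K * (a * P) * (2 * sint r W))
      by (apply Rmult_le_compat_l; assumption).
    lra. }
  assert (main'' : K / 4 * P * X <= r ^ 2 * N) by nra.
  apply Rmult_le_reg_l with (r ^ 2); [exact hr2|].
  replace (r ^ 2 * (P * (K / 4 * / r ^ 2 * X))) with (K / 4 * P * X) by (field; lra).
  exact main''.
Qed.

(** * Complex polarisations: numerator, denominator and limit *)

Lemma unit_vec_parts (b : C3) :
  unit_vec b -> dotr (re3 b) (re3 b) + dotr (im3 b) (im3 b) = 1.
Proof.
  unfold unit_vec; destruct b as [[[b1 c1] [b2 c2]] [b3 c3]]; unfold cnorm3, Cmod; cbn [fst snd].
  intros h.
  assert (sq : forall u v, sqrt (u ^ 2 + v ^ 2) ^ 2 = u ^ 2 + v ^ 2)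
    by (intros; apply pow2_sqrt; nra).
  rewrite !sq in h.
  apply (f_equal (fun t => t ^ 2)) in h; rewrite pow2_sqrt in h by nra.
  unfold dotr, sum3, re3, im3; cbn [coord comp1 comp2 comp3 fst snd]; lra.
Qed.

Lemma unit_vec_parts_le (b : C3) :
  unit_vec b -> dotr (re3 b) (re3 b) <= 1 /\ dotr (im3 b) (im3 b) <= 1.
Proof.
  intros hb; assert (e := unit_vec_parts b hb).
  assert (h1 := dotr_self_pos (re3 b)); assert (h2 := dotr_self_pos (im3 b)); lra.
Qed.

Lemma norm3_le_1 (p : R3) : dotr p p <= 1 -> norm3 p <= 1.
Proof.
  intros h; rewrite norm3_dotr, <- sqrt_1; apply sqrt_le_1_alt, h.
Qed.

Lemma sum3_abs_le (F : axis -> R) (M : R) :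
  (forall i, Rabs (F i) <= M) -> Rabs (sum3 F) <= 3 * M.
Proof.
  intros h; unfold sum3.
  assert (h1 := h Ax1); assert (h2 := h Ax2); assert (h3 := h Ax3).
  apply Rabs_le_between in h1, h2, h3; apply Rabs_le; lra.
Qed.

Lemma pairing_dipole_le (r : R) (n : nat) (y : R3) (alpha : C3) :
  0 < r -> in_ball r y -> unit_vec alpha ->
  exists C, 0 <= C /\ forall z beta, in_ball r z -> unit_vec beta ->
    Cmod (pairing r n (dipole y alpha) (dipole z beta))
    <= C * sint r (fun x => invdist r z x ^ 2).
Proof.
  intros hr hy halpha.
  assert (hd : 0 < r - norm3 y) by (unfold in_ball in hy; lra).
  destruct (ev_bounded r _ (Nat.iter n (lapE r) (dipE Ax1)) hr hd) as [C1 [p1 H1]].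
  destruct (ev_bounded r _ (Nat.iter n (lapE r) (dipE Ax2)) hr hd) as [C2 [p2 H2]].
  destruct (ev_bounded r _ (Nat.iter n (lapE r) (dipE Ax3)) hr hd) as [C3 [p3 H3]].
  set (M := C1 + C2 + C3).
  assert (HM : forall i p x, on_sphere r x -> dotr p p <= 1 ->
            Rabs (ev r y p (Nat.iter n (lapE r) (dipE i)) x) <= M).
  { intros i p x hx hp.
    assert (hy' : norm3 y <= r) by (unfold in_ball in hy; lra).
    assert (hp' := norm3_le_1 p hp); assert (hdist := sqdist_ge r y x hr hx).
    unfold M; destruct i;
      [specialize (H1 y p x hx hy' hp' hdist) | specialize (H2 y p x hx hy' hp' hdist)
      | specialize (H3 y p x hx hy' hp' hdist)]; lra. }
  (* The real and the imaginary part are each made of two real pairings with three components, hence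
     6 M; [Cmod_2Rmax] adds the factor sqrt 2 <= 2. *)
  exists (12 * M); split; [unfold M; lra|].
  intros z beta hz hbeta.
  assert (E := pairing_represents r y z alpha beta dipE dipE _ _ n hr hy hz
    (dipole_represents r y alpha hr hy) (dipole_represents r z beta hr hz)).
  cbv zeta in E; rewrite E; clear E.
  destruct (unit_vec_parts_le alpha halpha) as [ha1 ha2].
  destruct (unit_vec_parts_le beta hbeta) as [hb1 hb2].
  set (I2 := sint r (fun x => invdist r z x ^ 2)).
  assert (hI : forall p q, dotr p p <= 1 -> dotr q q <= 1 ->
    Rabs (sum3 (fun i => sint r (fun x =>
      ev r y p (dipE i) x * ev r z q (Nat.iter n (lapE r) (dipE i)) x))) <= 3 * (M * I2)).
  { intros p q hp hq; apply sum3_abs_le; intros i.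
    rewrite sint_iter_lapE by assumption.
    assert (cU := invdist_cont r z 2 hr hz).
    unfold I2; rewrite <- sint_scal by exact cU.
    apply sint_abs_le.
    - apply sph_cont_mult; apply ev_cont; assumption.
    - apply sph_cont_mult; [apply sph_cont_const | exact cU].
    - intros x hx; rewrite Rabs_mult; apply Rmult_le_compat; auto using Rabs_pos, dipE_le. }
  assert (k1 := hI _ _ ha1 hb1); assert (k2 := hI _ _ ha2 hb2).
  assert (k3 := hI _ _ ha2 hb1); assert (k4 := hI _ _ ha1 hb2).
  eapply Rle_trans; [apply Cmod_2Rmax|]; cbn [fst snd].
  apply Rabs_le_between in k1, k2, k3, k4.
  replace (12 * M * I2) with (2 * (6 * (M * I2))) by ring.
  apply Rmult_le_compat.
  - apply sqrt_pos.
  - eapply Rle_trans; [apply Rabs_pos | apply Rmax_l].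
  - rewrite <- (sqrt_pow2 2) at 2 by lra; apply sqrt_le_1_alt; lra.
  - apply Rmax_lub; apply Rabs_le; lra.
Qed.

Lemma pairing_dipole_self_ge (r : R) (m : nat) :
  0 < r ->
  exists k c, 0 < k /\ forall z beta, in_ball r z -> 0 < dotr z z -> unit_vec beta ->
    k * sint r (fun x => invdist r z x ^ 4) - c
    <= Re (pairing r (m + m) (dipole z beta) (dipole z beta)).
Proof.
  intros hr.
  assert (hPI := PI_RGT_0).
  destruct (poincare_iter r (dipE Ax1) m hr) as [A1 [B1 [a1 [b1 H1]]]].
  destruct (poincare_iter r (dipE Ax2) m hr) as [A2 [B2 [a2 [b2 H2]]]].
  destruct (poincare_iter r (dipE Ax3) m hr) as [A3 [B3 [a3 [b3 H3]]]].
  (* The 1 makes A positive, as required to divide by it. *)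
  set (A := 1 + A1 + A2 + A3).
  set (B := B1 + B2 + B3).
  assert (hA : 0 < A) by (unfold A; lra).
  assert (hr2 : 0 < r ^ 2) by (apply pow_lt; exact hr).
  set (K := / (64 * PI ^ 2 * r ^ 2)).
  assert (hK : 0 < K).
  { apply Rinv_0_lt_compat, Rmult_lt_0_compat; [|exact hr2].
    assert (0 < PI ^ 2) by (apply pow_lt; lra); lra. }
  exists (K * (r ^ 2 / 4) / A), ((K * PI + 2 * B) / A).
  split.
  { apply Rdiv_lt_0_compat; [apply Rmult_lt_0_compat; lra | exact hA]. }
  intros z beta hz ha hbeta.
  assert (E := pairing_represents r z z beta beta dipE dipE _ _ (m + m) hr hz hz
    (dipole_represents r z beta hr hz) (dipole_represents r z beta hr hz)).
  cbv zeta in E; rewrite E; clear E; cbn [Re fst].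
  destruct (unit_vec_parts_le beta hbeta) as [hb1 hb2].
  assert (hsum := unit_vec_parts beta hbeta).
  set (p := re3 beta) in *; set (q := im3 beta) in *.
  set (X := r ^ 2 / 4 * sint r (fun x => invdist r z x ^ 4) - PI).
  set (D := fun p => sum3 (fun i => sint r (fun x =>
    ev r z p (dipE i) x * ev r z p (Nat.iter (m + m) (lapE r) (dipE i)) x))).
  (* Neither part of beta is bounded below by itself, so the bound is kept proportional to |p|^2;
     the two instances are added using |p|^2 + |q|^2 = 1, at the price of 2 B. *)
  assert (hD : forall p, dotr p p <= 1 -> dotr p p * (K * X) <= A * D p + B).
  { intros p' hp.
    assert (hp' := norm3_le_1 p' hp).
    assert (h := dipE_norm_ge r z p' hr hz ha); fold K X in h.
    eapply Rle_trans; [exact h|]; clear h.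
    set (F := fun i => sint r (fun x => ev r z p' (Nat.iter m (lapE r) (dipE i)) x ^ 2)).
    assert (eD : D p' = sum3 F).
    { assert (e : forall i, sint r (fun x =>
          ev r z p' (dipE i) x * ev r z p' (Nat.iter (m + m) (lapE r) (dipE i)) x) = F i).
      { intros i; rewrite Nat.iter_add, sint_iter_lapE by assumption.
        apply sint_ext; intros; ring. }
      unfold D, sum3; rewrite !e; reflexivity. }
    assert (F0 : forall i, 0 <= F i).
    { intros i; replace 0 with (sint r (fun _ => 0)) by (rewrite sint_const; ring).
      apply sint_le; [apply sph_cont_const | apply sph_cont_pow, ev_cont; assumption |].
      intros; apply pow2_ge_0. }
    assert (f1 := F0 Ax1); assert (f2 := F0 Ax2); assert (f3 := F0 Ax3).
    specialize (H1 z p' hz hp'); specialize (H2 z p' hz hp'); specialize (H3 z p' hz hp').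
    fold (F Ax1) in H1; fold (F Ax2) in H2; fold (F Ax3) in H3.
    assert (c1 : A1 * F Ax1 <= A * F Ax1) by (apply Rmult_le_compat_r; unfold A; lra).
    assert (c2 : A2 * F Ax2 <= A * F Ax2) by (apply Rmult_le_compat_r; unfold A; lra).
    assert (c3 : A3 * F Ax3 <= A * F Ax3) by (apply Rmult_le_compat_r; unfold A; lra).
    rewrite eD; unfold sum3, B; lra. }
  assert (k1 := hD p hb1); assert (k2 := hD q hb2).
  fold (D p) (D q).
  assert (k3 : K * X <= A * (D p + D q) + 2 * B).
  { replace (K * X) with (dotr p p * (K * X) + dotr q q * (K * X))
      by (rewrite <- Rmult_plus_distr_r, hsum; ring).
    lra. }
  apply Rmult_le_reg_l with A; [exact hA|].
  replace (A * (K * (r ^ 2 / 4) / A * sint r (fun x => invdist r z x ^ 4) - (K * PI + 2 * B) / A))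
    with (K * X - 2 * B) by (unfold X; field; lra).
  lra.
Qed.

Theorem theorem3p1 (r : R) (hr : 0 < r)
    (gamma : nat) (hgamma : Nat.Even gamma)
    (y : R3) (hy : in_ball r y)
    (alpha : C3) (halpha : unit_vec alpha) :
  forall eps : R, 0 < eps ->
  exists delta : R, 0 < delta /\
    forall z : R3, in_ball r z -> Rabs (norm3 z - r) < delta ->
    forall beta : C3, unit_vec beta ->
      Cmod (psf r gamma y alpha z beta) < eps.
Proof.
  intros eps heps.
  destruct hgamma as [m hm].
  replace (2 * m)%nat with (m + m)%nat in hm by ring; subst gamma.
  destruct (pairing_dipole_le r (m + m) y alpha hr hy halpha) as [C [hC Hnum]].
  destruct (pairing_dipole_self_ge r m hr) as [k [c [hk Hden]]].
  assert (hPI := PI_RGT_0).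
  assert (hr2 : 0 < r ^ 2) by (apply pow_lt; exact hr).
  set (S := 4 * PI * r ^ 2).
  assert (hS : 0 < S) by (apply Rmult_lt_0_compat; lra).
  (* The L2 mass of 1/|x-z|^2 is S J^2 with J = 1/(r^2-|z|^2); the denominator
     is at least kappa J, the numerator at most C (S/theta^2 + 12 pi r theta J). *)
  set (kappa := sqrt (k * S / 2)).
  assert (hkS : 0 < k * S) by (apply Rmult_lt_0_compat; assumption).
  assert (hkappa : 0 < kappa) by (apply sqrt_lt_R0; lra).
  (* With this choice the part of the numerator linear in J is at most eps kappa J / 2; the [+ 1]
     covers C = 0. *)
  set (theta := eps * kappa / (2 * (C * (12 * PI * r) + 1))).
  assert (hc0 : 0 <= C * (12 * PI * r)).
  { apply Rmult_le_pos; [exact hC|]; apply Rmult_le_pos; lra. }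
  assert (htheta : 0 < theta).
  { apply Rdiv_lt_0_compat; [apply Rmult_lt_0_compat; assumption | lra]. }
  (* One summand for each use of J > J0: J <= J^2; z different from 0; c at most half of the main
     term in the denominator; the bounded part of the numerator below eps kappa J / 2. *)
  set (J0 := 1 + 2 / r ^ 2 + 2 * Rabs c / (k * S) + 2 * (C * S / theta ^ 2) / (eps * kappa)).
  assert (hth2 : 0 < theta ^ 2) by (apply pow_lt; exact htheta).
  assert (hek : 0 < eps * kappa) by (apply Rmult_lt_0_compat; assumption).
  assert (j1 : 0 < 2 / r ^ 2) by (apply Rdiv_lt_0_compat; lra).
  assert (j2 : 0 <= 2 * Rabs c / (k * S)).
  { apply Rdiv_le_0_compat; [|exact hkS]; assert (h := Rabs_pos c); lra. }
  assert (hCS : 0 <= C * S / theta ^ 2).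
  { apply Rdiv_le_0_compat; [apply Rmult_le_pos; lra | exact hth2]. }
  assert (j3 : 0 <= 2 * (C * S / theta ^ 2) / (eps * kappa))
    by (apply Rdiv_le_0_compat; lra).
  assert (hJ0 : 1 <= J0) by (unfold J0; lra).
  (* Since r^2 - |z|^2 <= 2 r (r - |z|), this distance forces J > J0. *)
  exists (/ (2 * r * J0)); split.
  { apply Rinv_0_lt_compat; repeat apply Rmult_lt_0_compat; lra. }
  intros z hz hzr beta hbeta.
  assert (hnz := norm3_pos z).
  unfold in_ball in hz; rewrite Rabs_left in hzr by lra.
  set (b := r ^ 2 - dotr z z).
  assert (hb : 0 < b) by (unfold b; rewrite <- norm3_sqr; nra).
  assert (hbJ : b < / J0).
  { apply Rle_lt_trans with (2 * r * (r - norm3 z)).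
    - unfold b; rewrite <- norm3_sqr; nra.
    - replace (/ J0) with (2 * r * / (2 * r * J0)) by (field; lra).
      apply Rmult_lt_compat_l; lra. }
  set (J := / b).
  assert (hJ : J0 < J).
  { rewrite <- (Rinv_inv J0); apply Rinv_lt_contravar; [|exact hbJ].
    apply Rmult_lt_0_compat; [exact hb | apply Rinv_0_lt_compat; lra]. }
  assert (hzz : 0 < dotr z z).
  { assert (/ J0 <= r ^ 2 / 2).
    { replace (r ^ 2 / 2) with (/ (2 / r ^ 2)) by (field; lra).
      apply Rinv_le_contravar; unfold J0; lra. }
    unfold b in hbJ; lra. }
  assert (N := Hnum z beta hz hbeta).
  assert (D := Hden z beta hz hzz hbeta).
  rewrite sint_invdist4 in D by assumption; fold b S J in D.
  (* The threshold shrinks like 1 / J, so the u^4 term stays bounded while the u term is a small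
     multiple of J. *)
  set (t := / (J * theta)).
  assert (hJt : 0 < J * theta) by (apply Rmult_lt_0_compat; lra).
  assert (ht : 0 < t) by (apply Rinv_0_lt_compat, hJt).
  assert (N2 := sint_invdist2 r z t hr hz ht); fold b S J in N2.
  replace (t ^ 2 * (S * J ^ 2) + 12 * PI * r / t)
    with (S / theta ^ 2 + 12 * PI * r * (J * theta)) in N2
    by (unfold t; field; lra).
  (* Half of k S J^2 pays for c, using J >= 1; monotonicity of [sqrt] then gives the bound, and with
     it that the denominator is positive. *)
  assert (hDen : kappa * J <= seminorm r (m + m) (dipole z beta)).
  { unfold seminorm, kappa.
    rewrite <- (sqrt_pow2 J) by lra; rewrite <- sqrt_mult by (try apply pow2_ge_0; lra).
    apply sqrt_le_1_alt; eapply Rle_trans; [|exact D].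
    assert (hc : c <= k * S / 2 * J).
    { apply Rle_trans with (Rabs c); [apply Rle_abs|].
      replace (Rabs c) with (k * S / 2 * (2 * Rabs c / (k * S))) by (field; lra).
      apply Rmult_le_compat_l; [lra|]; unfold J0 in hJ; lra. }
    assert (k * S / 2 * J <= k * S / 2 * J ^ 2) by (apply Rmult_le_compat_l; nra).
    lra. }
  assert (hkJ : 0 < kappa * J) by (apply Rmult_lt_0_compat; lra).
  set (d := seminorm r (m + m) (dipole z beta)) in *.
  unfold psf; fold d.
  rewrite Cmod_div by (intros e; apply RtoC_inj in e; lra).
  rewrite Cmod_R, Rabs_pos_eq by lra.
  apply Rlt_div_l; [lra|].
  apply Rlt_le_trans with (eps * (kappa * J)); [|apply Rmult_le_compat_l; lra].
  eapply Rle_lt_trans; [exact N|].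
  apply Rle_lt_trans with (C * (S / theta ^ 2 + 12 * PI * r * (J * theta)));
    [apply Rmult_le_compat_l; assumption|].
  assert (h1 : C * S / theta ^ 2 < eps * kappa / 2 * J).
  { replace (C * S / theta ^ 2)
      with (eps * kappa / 2 * (2 * (C * S / theta ^ 2) / (eps * kappa))) by (field; lra).
    apply Rmult_lt_compat_l; [lra|]; unfold J0 in hJ; lra. }
  assert (h2 : C * (12 * PI * r) * theta <= eps * kappa / 2).
  { replace (eps * kappa / 2) with ((C * (12 * PI * r) + 1) * theta)
      by (unfold theta; field; lra).
    apply Rmult_le_compat_r; lra. }
  assert (h3 : C * (12 * PI * r) * theta * J <= eps * kappa / 2 * J)
    by (apply Rmult_le_compat_r; lra).
  replace (C * (S / theta ^ 2 + 12 * PI * r * (J * theta)))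
    with (C * S / theta ^ 2 + C * (12 * PI * r) * theta * J) by (field; lra).
  lra.
Qed.
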